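(* Let $K\ge 1$, let $P\in\mathbb{R}^{K\times K}$ be a substochastic matrix that is convergent (i.e. has spectral radius strictly less than $1$), and set $R=I-P^T$. Let $(\alpha,\mu)\in(\mathbb{D}^\uparrow_{\mathcal M})^K\times(\mathbb{D}^\uparrow)^K$ with $\mu(0)=0$. Then there exists a unique $(\xi,\beta,\iota)\in\mathbb{D}_{\mathcal M}^K\times(\mathbb{D}^\uparrow_{\mathcal M})^K\times(\mathbb{D}^\uparrow)^K$ such that for every $x\in\mathbb{R}_+$: (1) $\xi[0,x]=\alpha[0,x]-R\,\beta[0,x]$ (as an identity of $\mathbb{R}^K$-valued paths); (2) $\int_{[0,\infty)}\xi^i_s[0,x]\,d\beta^i_s(x,\infty)=0$ for all $i\in\{1,\dots,K\}$; (3) $\int_{[0,\infty)}\xi^i_s[0,x]\,d\iota^i(s)=0$ for all $i\in\{1,\dots,K\}$; (4) $\beta[0,\infty)+\iota=\mu$. (Here the integration variable in (2),(3) is $s$.)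
   Context: $\mathbb{R}_+=[0,\infty)$. $\mathcal M$ is the space of finite Borel measures on $\mathbb{R}_+$ with the topology of weak convergence. $\mathbb{D}$ denotes càdlàg functions $\mathbb{R}_+\to\mathbb{R}$, $\mathbb{D}^\uparrow$ its subset of nondecreasing nonnegative functions, and $\mathbb{D}_{\mathcal M}$ the càdlàg functions $\mathbb{R}_+\to\mathcal M$. $\mathbb{D}^\uparrow_{\mathcal M}$ is the set of $\zeta\in\mathbb{D}_{\mathcal M}$ such that $t\mapsto\int f\,d\zeta_t$ is nondecreasing for every continuous bounded nonnegative $f$. Superscript $K$ denotes $K$-fold products; for $\zeta=(\zeta^1,\dots,\zeta^K)$ and a Borel set $B$, $\zeta_t(B)=(\zeta^1_t(B),\dots,\zeta^K_t(B))$. We write $\zeta[a,b]$ for $\zeta([a,b])$ etc. A triple satisfying (1)–(4) is called a solution of the vector measure valued Skorokhod problem (VMVSP) associated with $P$ for the data $(\alpha,\mu)$. *)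

(* Defs.v *)
From HB Require Import structures.
From mathcomp Require Import all_boot all_order all_algebra.
From mathcomp Require Import all_classical all_reals all_analysis.
From mathcomp.real_closed Require Import complex.
Set Implicit Arguments. Unset Strict Implicit. Unset Printing Implicit Defensive.
Import Order.TTheory GRing.Theory Num.Theory numFieldNormedType.Exports numFieldTopology.Exports.
Local Open Scope classical_set_scope.
Local Open Scope ring_scope.

Section Defs.
Variable R : realType.

Definition bR := measurableTypeR R.

Definition Rp : set R := [set x | 0 <= x].

(** Elements of M: finite Borel measures on R_+, represented as finite
    Borel measures on R that give no mass to (-oo, 0). *)
Definition fmeas := {finite_measure set bR -> \bar R}.
Definition onRp (m : fmeas) : Prop := m [set x : bR | x < 0] = 0%E.

Definition mint (m : fmeas) (f : R -> R) : \bar R :=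
  (\int[m]_(x in (Rp : set bR)) (f x)%:E)%E.

Definition cb (f : R -> R) : Prop :=
  {within Rp, continuous f} /\ exists M : R, forall x, 0 <= x -> `|f x| <= M.

(** D : cadlag functions R_+ -> R (only the values on R_+ matter). *)
Definition cadlag (g : R -> R) : Prop :=
  (forall t, 0 <= t -> g x @[x --> t^'+] --> g t) /\
  (forall t, 0 < t -> cvg (g x @[x --> t^'-])).

Definition Dup (g : R -> R) : Prop :=
  cadlag g /\ (forall t, 0 <= t -> 0 <= g t) /\
  (forall s t, 0 <= s -> s <= t -> g s <= g t).

(** D_M : cadlag paths R_+ -> M, M with the topology of weak convergence.
    Weak topology = initial topology of the maps m |-> int f dm (f
    continuous bounded), so convergence in it means convergence of all
    these integrals. *)
Definition DM (z : R -> fmeas) : Prop :=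
  (forall t, 0 <= t -> onRp (z t)) /\
  (forall t, 0 <= t -> forall f, cb f ->
      mint (z s) f @[s --> t^'+] --> mint (z t) f) /\
  (forall t, 0 < t -> exists nu : fmeas, onRp nu /\
      forall f, cb f -> mint (z s) f @[s --> t^'-] --> mint nu f).

Definition DMup (z : R -> fmeas) : Prop :=
  DM z /\ forall f, cb f -> (forall x, 0 <= x -> 0 <= f x) ->
    forall s t, 0 <= s -> s <= t -> (mint (z s) f <= mint (z t) f)%E.

Definition mv (m : fmeas) (A : set bR) : R := fine (m A).

(** Lebesgue--Stieltjes measure dg on [0,oo) of a nondecreasing
    right-continuous g : R_+ -> R with g >= 0, with the convention
    g(0-) = 0 (so the integral over [0,oo) sees a possible jump at 0).
    If the extension is not cumulative we default to the zero function
    (this case never arises for the functions used below). *)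
Definition ext0 (g : R -> R) : R -> R := fun s => if s < 0 then 0 else g s.

Definition cumul_part (G : R -> R) : R -> R :=
  if pselect ((forall x y, x <= y -> G x <= G y) /\
              (forall x, G%function @ at_right x --> G%function x))
  then G else (fun _ => 0).

Lemma cumul_part_nd G : nondecreasing (cumul_part G).
Proof.
rewrite /cumul_part; destruct (pselect _) as [p|n].
  by move=> x y; exact: (proj1 p).
by move=> x y _.
Qed.

Lemma cumul_part_rc G :
  forall x, (cumul_part G)%function @ at_right x --> (cumul_part G)%function x.
Proof.
rewrite /cumul_part; destruct (pselect _) as [p|n]; first exact: (proj2 p).
move=> x; exact: cvg_cst.
Qed.

HB.instance Definition _ (G : R -> R) :=
  isCumulative.Build R _ R (cumul_part G) (@cumul_part_nd G) (@cumul_part_rc G).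

Definition dmeas (g : R -> R) :=
  lebesgue_stieltjes_measure (cumul_part (ext0 g)).

Definition sint (h : R -> \bar R) (g : R -> R) : \bar R :=
  (\int[dmeas g]_(s in (Rp : set bR)) h s)%E.

Definition substochastic K (P : 'M[R]_K) : Prop :=
  (forall i j, 0 <= P i j) /\ (forall i, \sum_j P i j <= 1).

Definition convergent K (P : 'M[R]_K) : Prop :=
  forall l : R[i], eigenvalue (map_mx (fun x => x%:C)%C P) l -> `|l| < 1.

Definition VMVSP K (P : 'M[R]_K) (alpha : 'I_K -> R -> fmeas) (mu : 'I_K -> R -> R)
  (xi beta : 'I_K -> R -> fmeas) (iota : 'I_K -> R -> R) : Prop :=
  forall x, 0 <= x ->
  [/\ (* (1) *) forall i s, 0 <= s ->
        mv (xi i s) `[0, x]%classic = mv (alpha i s) `[0, x]%classic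
          - \sum_j (1%:M - P^T) i j * mv (beta j s) `[0, x]%classic,
      (* (2) *) forall i,
        sint (fun s => xi i s `[0, x]%classic) (fun s => mv (beta i s) `]x, +oo[%classic) = 0%E,
      (* (3) *) forall i, sint (fun s => xi i s `[0, x]%classic) (iota i) = 0%E
    & (* (4) *) forall i s, 0 <= s -> mv (beta i s) `[0, +oo[%classic + iota i s = mu i s].

End Defs.

(* Main.v *)
Require Import Defs.
From HB Require Import structures.
From mathcomp Require Import all_boot all_order all_algebra.
From mathcomp Require Import all_classical all_reals all_analysis.
From mathcomp.real_closed Require Import complex.
From mathcomp Require Import lra unstable measurable_realfun.
Set Implicit Arguments. Unset Strict Implicit. Unset Printing Implicit Defensive.
Import Order.TTheory GRing.Theory Num.Theory numFieldNormedType.Exports numFieldTopology.Exports.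
Local Open Scope classical_set_scope.
Local Open Scope ring_scope.

(** For fixed [x], write [B = beta[0,x]], [a = alpha[0,x]] and
    [L = mu - B = beta(x,oo) + iota].  Conditions (1)-(4) say that [L i] is the
    one-dimensional Skorokhod regulator of [a i + sum_j P j i B j - mu i], so that
    [B] is a fixed point of
    [B |-> mu i - sup_(s <= t) (mu i - a i - sum_j P j i B j)^+].
    This map is monotone, and nonexpansive at each time, for the order "the
    difference of the two paths is nonnegative and nondecreasing": a least fixed
    point is therefore reached by iteration from [0], and it is monotone in [a].
    Two comparable fixed points differ at each time by some [v >= 0] with
    [v <= v P], which forces [v = 0] when [P] is substochastic and convergent; the
    same estimate gives right continuity in [x] and the limit [x -> oo].
    Monotonicity in [a] says exactly that [x |-> B_x(t)] and
    [x |-> a_x(t) - R B_x(t)] are distribution functions of measures and that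
    [t |-> beta_t] is nondecreasing. *)

(** * Nonnegative nondecreasing paths and the order they generate *)

Section increasing_paths.
Variable R : realType.
Implicit Types f g h : R -> R.

(** Row sums of [P] may equal 1, so the fixed-point map need not contract the sum norm; [convergent]
    is used only through the absence of a nonzero [v >= 0] with [v <= v P]. That criterion needs a
    sign, hence comparable paths, and two arbitrary fixed points are not known to be comparable.
    Each of them is comparable with the least one, and therefore equal to it.

    The pointwise order would be too weak twice over: the estimate of the regulator at a single time
    needs [A' - A] nondecreasing, and the mass of []x, y]] under [beta] has to grow in time.

    Weak convergence costs little for measures ordered in this sense, since convergence of total
    masses already controls every test function. Only [xi], which is not monotone in time, has to be
    handled as a linear combination of monotone paths.

    The integral conditions are delicate because [mu] and [alpha] may jump: the set where the
    reflected path is positive is only open to the right, and a jump at the left end of an interval,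
    or at time 0, must be counted. *)

Definition incr f :=
  (forall t, 0 <= t -> 0 <= f t) /\ (forall s t, 0 <= s -> s <= t -> f s <= f t).

Definition incr_le f g := incr (fun t => g t - f t).

Definition rightc f := forall t, 0 <= t -> f s @[s --> t^'+] --> f t.

Lemma incr0 : incr (fun=> 0). Proof. by split. Qed.

Lemma incr_ge0 f : incr f -> incr_le (fun=> 0) f.
Proof. by move=> [f0 fm]; split=> [t t0|s t s0 st]; rewrite !subr0; auto. Qed.

Lemma incr_le_refl f : incr_le f f.
Proof. by split=> *; rewrite !subrr. Qed.

Lemma incr_leP f g t : incr_le f g -> 0 <= t -> f t <= g t.
Proof. by move=> [h _] /h; rewrite subr_ge0. Qed.

Lemma incr_le_incr f g : incr f -> incr_le f g -> incr g.
Proof.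
move=> [f0 fm] [d0 dm]; split=> [t t0|s t s0 st].
  by have := f0 t t0; have := d0 t t0; lra.
by have := fm s t s0 st; have := dm s t s0 st; lra.
Qed.

Lemma incr_le_trans g f h : incr_le f g -> incr_le g h -> incr_le f h.
Proof.
move=> [f0 fm] [d0 dm]; split=> [t t0|s t s0 st].
  by have := f0 t t0; have := d0 t t0; lra.
by have := fm s t s0 st; have := dm s t s0 st; lra.
Qed.

Lemma incrD f g : incr f -> incr g -> incr (fun t => f t + g t).
Proof.
move=> [f0 fm] [g0 gm]; split=> [t t0|s t s0 st]; first by rewrite addr_ge0 ?f0 ?g0.
by rewrite lerD ?fm ?gm.
Qed.

Lemma incr_sum (I : finType) (c : I -> R) (f : I -> R -> R) :
  (forall i, 0 <= c i) -> (forall i, incr (f i)) -> incr (fun t => \sum_i c i * f i t).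
Proof.
move=> c0 fi; split=> [t t0|s t s0 st].
  by apply: sumr_ge0 => i _; rewrite mulr_ge0 ?c0//; apply: (fi i).1.
by apply: ler_sum => i _; rewrite ler_wpM2l ?c0//; apply: (fi i).2.
Qed.

Lemma incr_cvg (u : nat -> R -> R) f : (forall n, incr (u n)) ->
  (forall t, 0 <= t -> u n t @[n --> \oo] --> f t) -> incr f.
Proof.
move=> ui uf; split=> [t t0|s t s0 st].
  apply: (ler_cvg_to (cvg_cst 0) (uf t t0)); apply: nearW => n; exact: (ui n).1.
apply: (ler_cvg_to (uf s s0) (uf t (le_trans s0 st))); apply: nearW => n.
exact: (ui n).2.
Qed.

Lemma eq_incr f g : (forall t, 0 <= t -> f t = g t) -> incr f -> incr g.
Proof.
move=> fg [f0 fm]; split=> [t t0|s t s0 st]; first by rewrite -fg ?f0.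
by rewrite -!fg ?fm// (le_trans s0).
Qed.

(** Increments of [f] lie between 0 and those of [g]. Flows inherit right continuity from [mu] in
    this way, and masses of intervals inherit it from the total mass. *)
Lemma rightc_incr_le f g : incr f -> incr_le f g -> rightc g -> rightc f.
Proof.
move=> [_ fm] [_ dm] rg t t0.
apply: (@squeeze_cvgr _ _ _ _ (fun=> f t) (fun s => f t + (g s - g t))).
- near=> s; have ts : t <= s by [].
  by rewrite fm//=; have := dm t s t0 ts; lra.
- exact: cvg_cst.
- rewrite -[X in _ --> X]addr0; apply: cvgD; first exact: cvg_cst.
  by rewrite -(subrr (g t)); apply: cvgB; [exact: rg|exact: cvg_cst].
Unshelve. all: by end_near. Qed.

End increasing_paths.

(** * One-dimensional reflection *)

Section regulator.
Variables (R : realType) (mu : R -> R).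
Hypothesis mui : incr mu.
Implicit Types A : R -> R.

(** One-dimensional Skorokhod map: the least nonnegative nondecreasing path that keeps
    [A - mu + reg A] nonnegative. When [A] is nonnegative the supremum is finite, being at most
    [mu t]. *)
Definition reg A t := sup [set Num.max 0 (mu s - A s) | s in [set s | 0 <= s <= t]].

Let reg_set A t := [set Num.max 0 (mu s - A s) | s in [set s | 0 <= s <= t]].

Let has_ub A t : incr A -> 0 <= t -> has_ubound (reg_set A t).
Proof.
move=> [A0 _] t0; exists (mu t) => _ [s /andP[s0 st] <-].
rewrite ge_max mui.1//=; have := A0 s s0; have := mui.2 s t s0 st; lra.
Qed.

Lemma reg_ub A s t : incr A -> 0 <= s -> s <= t -> mu s - A s <= reg A t.
Proof.
move=> iA s0 st; apply: (@le_trans _ _ (Num.max 0 (mu s - A s))).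
  by rewrite le_max lexx orbT.
apply: ub_le_sup; first by apply: has_ub => //; exact: le_trans st.
by exists s => //=; rewrite s0.
Qed.

Lemma reg_ge0 A t : incr A -> 0 <= t -> 0 <= reg A t.
Proof.
move=> iA t0; apply: (@le_trans _ _ (Num.max 0 (mu t - A t))).
  by rewrite le_max lexx.
apply: ub_le_sup; first exact: has_ub.
by exists t => //=; rewrite t0 lexx.
Qed.

Lemma reg_le A t c : 0 <= t -> 0 <= c ->
  (forall s, 0 <= s -> s <= t -> mu s - A s <= c) -> reg A t <= c.
Proof.
move=> t0 c0 h; apply: ge_sup.
  by exists (Num.max 0 (mu 0 - A 0)), 0 => //=; rewrite lexx.
by move=> _ [s /andP[s0 st] <-]; rewrite ge_max c0 h.
Qed.

Lemma reg_mono A s t : incr A -> 0 <= s -> s <= t -> reg A s <= reg A t.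
Proof.
move=> iA s0 st; have t0 := le_trans s0 st.
apply: reg_le => //; first exact: reg_ge0.
by move=> u u0 us; apply: reg_ub => //; exact: le_trans st.
Qed.

Lemma reg_incr A : incr A -> incr (reg A).
Proof. by move=> iA; split=> [t|s t]; [exact: reg_ge0|exact: reg_mono]. Qed.

(** For [s <= t] the lead [A' - A] at [s] is at most its value at [t]; without this monotonicity the
    value at [t] would not control a supremum over earlier times. *)
Lemma reg_lip A A' t : incr A -> incr_le A A' -> 0 <= t ->
  reg A t <= reg A' t + (A' t - A t).
Proof.
move=> iA AA' t0; have iA' := incr_le_incr iA AA'.
apply: reg_le => //; first by rewrite addr_ge0 ?reg_ge0//; exact: AA'.1.
move=> s s0 st; have := reg_ub iA' s0 st; have := AA'.2 _ _ s0 st; lra.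
Qed.

(** Capacity [mu] less the part [reg A] not spent on [A]: the amount of [A] that is served. *)
Definition thr A t := mu t - reg A t.

Lemma thr_lip A A' t : incr A -> incr_le A A' -> 0 <= t ->
  thr A' t - thr A t <= A' t - A t.
Proof. by rewrite /thr => iA AA' t0; have := reg_lip iA AA' t0; lra. Qed.

Lemma thr_homo A A' : incr A -> incr_le A A' -> incr_le (thr A) (thr A').
Proof.
move=> iA AA'; have iA' := incr_le_incr iA AA'; rewrite /thr.
split=> [t t0|s t s0 st].
  suff : reg A' t <= reg A t by lra.
  apply: reg_le => //; first exact: reg_ge0.
  move=> s s0 st; have := reg_ub iA s0 st; have := AA'.1 s s0; lra.
have t0 := le_trans s0 st; have As := reg_mono iA s0 st.
suff : reg A' t <= reg A' s + (reg A t - reg A s) by lra.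
apply: reg_le => //; first by have := reg_ge0 iA' s0; lra.
move=> u u0 ut; have [us|su] := leP u s.
  have := reg_ub iA' u0 us; lra.
(* After [s] the lead [A' - A] is at least its value at [s], which [reg_lip] bounds below by
   [reg A s - reg A' s]. *)
have := reg_ub iA u0 ut; have := reg_lip iA AA' s0; have := AA'.2 _ _ s0 (ltW su).
lra.
Qed.

Lemma thr0 t : 0 <= t -> thr (fun=> 0) t = 0.
Proof.
move=> t0; rewrite /thr; apply/eqP; rewrite subr_eq0; apply/eqP/le_anti/andP; split.
  by have := reg_ub (incr0 R) t0 (lexx t); lra.
by apply: reg_le => //; [exact: mui.1|move=> s s0 st; rewrite subr0; exact: mui.2].
Qed.

Lemma thr_incr A : incr A -> incr (thr A).
Proof.
move=> iA; apply: eq_incr (thr_homo (incr0 R) (incr_ge0 iA)) => t t0.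
by rewrite thr0// subr0.
Qed.

Lemma thr_le A t : incr A -> 0 <= t -> thr A t <= mu t.
Proof. by move=> iA t0; rewrite /thr; have := reg_ge0 iA t0; lra. Qed.

(* [c] plays the role of the left limit of [reg A] at [a] (and of the
   convention [reg A (0-) = 0] when [a = 0]). *)
Lemma reg_flat A a b c : incr A -> rightc A -> rightc mu ->
  0 <= a -> a <= b -> 0 <= c -> (forall u, 0 <= u -> u < a -> reg A u <= c) ->
  (forall s, a <= s -> s <= b -> 0 < A s - mu s + reg A s) -> reg A b <= c.
Proof.
move=> iA rA rmu a0 ab c0 hc hX; rewrite leNgt; apply/negP => cb.
(* [T] collects the times at which [reg A] has exceeded [c]. At its infimum [tau], either [mu - A]
   reaches [c], and then [reg A tau <= mu tau - A tau] contradicts positivity, or it is below [c],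
   and right continuity keeps [reg A <= c] a little beyond [tau]. *)
pose T := [set s | a <= s <= b /\ c < reg A s].
have Tb : T b by rewrite /T/= ab lexx.
have lbT : has_lbound T by exists a => s [/andP[]].
pose tau := inf T.
have atau : a <= tau by apply: lb_le_inf; [exists b|move=> s [/andP[]]].
have taub : tau <= b by apply: ge_inf.
have tau0 := le_trans a0 atau.
have below u : 0 <= u -> u < tau -> reg A u <= c.
  move=> u0 ut; have [ua|au] := ltP u a; first exact: hc.
  rewrite leNgt; apply/negP => cu.
  suff : tau <= u by rewrite leNgt ut.
  by apply: ge_inf => //; rewrite /T/= au (ltW (lt_le_trans ut taub)).
have regtau : reg A tau <= Num.max c (mu tau - A tau).
  apply: reg_le => //; first by rewrite le_max c0.
  move=> s s0; rewrite le_eqVlt => /orP[/eqP->|stau]; first by rewrite le_max lexx orbT.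
  by rewrite le_max (le_trans (reg_ub iA s0 (lexx s)))// below.
have Xtau := hX tau atau taub.
have [cm|mc] := leP c (mu tau - A tau).
  by move: regtau; rewrite (max_idPr cm); lra.
have : (mu s - A s) @[s --> tau^'+] --> mu tau - A tau.
  by apply: cvgB; [exact: rmu|exact: rA].
move=> /cvgr_lt/(_ _ mc)[e /= e0 he].
suff : tau + e <= tau by lra.
apply: lb_le_inf; first by exists b.
move=> s [/andP[as_ sb] cs]; rewrite leNgt; apply/negP => se.
suff : reg A s <= c by lra.
apply: reg_le => //; first exact: le_trans as_.
move=> u u0 us; have [ut|tu] := ltP u tau.
  exact: le_trans (reg_ub iA u0 (lexx u)) (below _ u0 ut).
move: tu; rewrite le_eqVlt => /orP[/eqP<-|tu]; first exact: ltW.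
apply/ltW/he => //=; rewrite distrC ger0_norm; lra.
Qed.

End regulator.

Lemma cvg_sumr (R : realType) (I T : Type) (r : seq I) (F : set_system T)
    (f : I -> T -> R) (l : I -> R) : Filter F ->
  (forall i, f i x @[x --> F] --> l i) ->
  \sum_(i <- r) f i x @[x --> F] --> \sum_(i <- r) l i.
Proof.
move=> FF fl; apply: (@cvg_big _ _ +%R) => //.
by move=> -[x y]; exact: add_continuous.
Qed.

(** * Feedback through a convergent routing matrix *)

Section subinvariant.
Variables (R : realType) (K : nat) (P : 'M[R]_K).
Hypotheses (sP : substochastic P) (cP : convergent P).

(* Summing [v <= v P] and using that the row sums of [P] are at most 1 forces
   equality, so that a nonzero [v] would be an eigenvector for 1. *)
Lemma subinvariant0 (v : 'I_K -> R) : (forall i, 0 <= v i) ->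
  (forall i, v i <= \sum_j P j i * v j) -> forall i, v i = 0.
Proof.
case: sP => P0 P1 v0 vP.
have le_sum : \sum_i \sum_j P j i * v j <= \sum_i v i.
  rewrite exchange_big/=; apply: ler_sum => j _.
  by rewrite -mulr_suml ler_piMl.
have vE i : v i = \sum_j P j i * v j.
  apply/eqP; rewrite eq_le vP/= leNgt; apply/negP => lt_i.
  suff : \sum_i v i < \sum_i \sum_j P j i * v j by rewrite ltNge le_sum.
  rewrite (bigD1 i)//= [ltRHS](bigD1 i)//=; apply: ltr_leD => //.
  by apply: ler_sum.
move=> i; apply/eqP/negPn/negP => vi.
suff : `|1 : R[i]| < 1 by rewrite normr1 ltxx.
apply: cP; apply/eigenvalueP; exists (\row_j (v j)%:C)%C; last first.
  apply/eqP => /rowP/(_ i); rewrite !mxE => /(congr1 (@complex.Re R))/= /eqP.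
  by rewrite (negbTE vi).
apply/rowP => k; rewrite scale1r !mxE [in RHS]vE raddf_sum/=.
by apply: eq_bigr => j _; rewrite !mxE mulrC rmorphM.
Qed.

(** Monotonicity supplies the limits of [d]; the error [a] disappears in the limit, which is then
    subinvariant. No rate of convergence is involved. *)
Lemma subinvariant_cvg0 (d a : nat -> 'I_K -> R) :
  (forall n i, 0 <= d n i) -> (forall n m i, (n <= m)%N -> d m i <= d n i) ->
  (forall n i, d n i <= a n i + \sum_j P j i * d n j) ->
  (forall i, a n i @[n --> \oo] --> 0) -> forall i, d n i @[n --> \oo] --> 0.
Proof.
move=> d0 dm da a0.
have dcvg i : cvg (d n i @[n --> \oo]).
  apply: nonincreasing_is_cvgn; first by move=> n m nm; exact: dm.
  by exists 0 => _ [n _ <-].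
pose l i := lim (d n i @[n --> \oo]).
suff l0 i : l i = 0 by move=> i; rewrite -[X in _ --> X](l0 i); exact: dcvg.
apply: subinvariant0 => {}i.
  by apply: limr_ge => //; apply: nearW.
rewrite -[leRHS]add0r.
have /(ler_cvg_to (dcvg i)) :
    a n i + \sum_j P j i * d n j @[n --> \oo] --> 0 + \sum_j P j i * l j.
  apply: cvgD; first exact: a0.
  by apply: cvg_sumr => j; apply: cvgMr; exact: dcvg.
by apply; apply: nearW.
Qed.

End subinvariant.

(** * Flows of the network for given arrivals: existence, comparison, limits *)

Section network.
Variables (R : realType) (K : nat) (P : 'M[R]_K) (mu : 'I_K -> R -> R).
Hypotheses (sP : substochastic P) (cP : convergent P).
Hypothesis mui : forall i, incr (mu i).
Implicit Types (alpha B : 'I_K -> R -> R) (i j : 'I_K).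

Definition inflow alpha B i t := alpha i t + \sum_j P j i * B j t.

Lemma inflow_homo alpha alpha' B B' i :
  (forall i, incr_le (alpha i) (alpha' i)) -> (forall i, incr_le (B i) (B' i)) ->
  incr_le (inflow alpha B i) (inflow alpha' B' i).
Proof.
move=> ha hB; apply: eq_incr (incrD (ha i) (incr_sum (sP.1^~ i) hB)) => t t0.
rewrite /inflow opprD addrACA; congr (_ + _); rewrite -sumrB; apply: eq_bigr => j _.
by rewrite mulrBr.
Qed.

Lemma inflow_incr alpha B i : (forall i, incr (alpha i)) -> (forall i, incr (B i)) ->
  incr (inflow alpha B i).
Proof. by move=> ha hB; apply: incrD => //; apply: incr_sum => // j; exact: sP.1. Qed.

Definition is_flow alpha B := (forall i, incr (B i)) /\
  (forall i t, 0 <= t -> B i t = thr (mu i) (inflow alpha B i) t).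

(** Minimality is stated against every path that the map sends below itself, not only against fixed
    points: a flow for larger arrivals is such a path for the smaller ones, which is what
    [flow_homo] exploits. *)
Lemma least_flow alpha : (forall i, incr (alpha i)) ->
  exists2 B, is_flow alpha B & forall B', (forall i, incr (B' i)) ->
    (forall i, incr_le (thr (mu i) (inflow alpha B' i)) (B' i)) ->
    forall i, incr_le (B i) (B' i).
Proof.
move=> ia.
pose Phi B i := thr (mu i) (inflow alpha B i).
have Phi_incr B : (forall i, incr (B i)) -> forall i, incr (Phi B i).
  by move=> hB i; apply: thr_incr => //; exact: inflow_incr.
have Phi_homo B B' : (forall i, incr (B i)) -> (forall i, incr_le (B i) (B' i)) ->
    forall i, incr_le (Phi B i) (Phi B' i).
  move=> hB BB' i; apply: thr_homo => //; first exact: inflow_incr.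
  by apply: inflow_homo => // j; exact: incr_le_refl.
pose b n := iter n Phi (fun _ _ => 0).
have bi n i : incr (b n i).
  by elim: n i => [i|n IH i]; [exact: incr0|exact: Phi_incr].
have bS n i : incr_le (b n i) (b n.+1 i).
  elim: n i => [i|n IH i]; last exact: Phi_homo.
  by apply: incr_ge0; exact: (bi 1%N).
have blem n m i : (n <= m)%N -> incr_le (b n i) (b m i).
  elim: m => [|m IH]; first by rewrite leqn0 => /eqP->; exact: incr_le_refl.
  rewrite leq_eqVlt => /orP[/eqP->|]; last by move=> /IH /incr_le_trans; apply.
  exact: incr_le_refl.
have bmu n i t : 0 <= t -> b n i t <= mu i t.
  case: n => [|n] t0; first exact: (mui i).1.
  by apply: thr_le => //; exact: inflow_incr.
pose B i t := lim (b n i t @[n --> \oo]).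
have bB i t : 0 <= t -> b n i t @[n --> \oo] --> B i t.
  move=> t0; apply: nondecreasing_is_cvgn.
    by move=> n m nm; apply: incr_leP => //; exact: blem.
  by exists (mu i t) => _ [n _ <-]; exact: bmu.
have Bi i : incr (B i) by apply: (@incr_cvg _ (fun n => b n i)) => // t t0; exact: bB.
have bleB n i : incr_le (b n i) (B i).
  apply: (@incr_cvg _ (fun m t => b (n + m)%N i t - b n i t)).
    by move=> m; apply: blem; exact: leq_addr.
  move=> t t0; apply: cvgB; last exact: cvg_cst.
  have := bB i t t0; rewrite -(cvg_shiftn n (fun m => b m i t)).
  by under eq_fun do rewrite addnC.
exists B.
  split=> // i t t0.
  have cv1 : b n.+1 i t @[n --> \oo] --> B i t.
    by have := bB i t t0; rewrite -(cvg_shiftS (fun m => b m i t)).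
  suff cv2 : b n.+1 i t @[n --> \oo] --> thr (mu i) (inflow alpha B i) t.
    exact: cvg_unique cv1 cv2.
  (* [thr_lip] makes the map continuous along the iterates: the gap at time [t] is at most the gap
     between the inflows at the same [t], which tends to 0. *)
  apply: (@squeeze_cvgr _ _ _ _ (fun n => thr (mu i) (inflow alpha B i) t
     - (inflow alpha B i t - inflow alpha (b n) i t))); last 2 first.
  - rewrite -[X in _ --> X]subr0; apply: cvgB; first exact: cvg_cst.
    rewrite -(subrr (inflow alpha B i t)); apply: cvgB; first exact: cvg_cst.
    apply: cvgD; first exact: cvg_cst.
    by apply: cvg_sumr => j; apply: cvgMr; exact: bB.
  - exact: cvg_cst.
  apply: nearW => n.
  have iin := inflow_incr i ia (bi n).
  have hin := inflow_homo i (fun j => incr_le_refl (alpha j)) (bleB n).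
  have h1 := thr_lip (mui i) iin hin t0.
  have h2 := incr_leP (thr_homo (mui i) iin hin) t0.
  rewrite /b iterS -/(b n) /Phi; apply/andP; split; [lra|exact: h2].
move=> B' iB' hB' i.
have bB' n j : incr_le (b n j) (B' j).
  elim: n j => [j|n IH j]; first exact: incr_ge0.
  by apply: incr_le_trans (hB' j); exact: Phi_homo.
apply: (@incr_cvg _ (fun m t => B' i t - b m i t)); first by move=> m; exact: bB'.
by move=> t t0; apply: cvgB; [exact: cvg_cst|exact: bB].
Qed.

(** Comparability of the flows is a hypothesis because this estimate is needed inside the proof of
    [flow_homo], which later supplies it. *)
Lemma flow_lip_of_le alpha alpha' B B' i t : (forall i, incr (alpha i)) ->
  (forall i, incr_le (alpha i) (alpha' i)) -> is_flow alpha B -> is_flow alpha' B' ->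
  (forall i, incr_le (B i) (B' i)) -> 0 <= t ->
  B' i t - B i t <= alpha' i t - alpha i t + \sum_j P j i * (B' j t - B j t).
Proof.
move=> ia aa' [iB BE] [iB' BE'] BB' t0; rewrite BE// BE'//.
apply: le_trans (thr_lip (mui i) (inflow_incr i ia iB) (inflow_homo i aa' BB') t0) _.
rewrite /inflow opprD addrACA -sumrB lerD2l.
by apply: ler_sum => j _; rewrite mulrBr.
Qed.

(** The least flow [C] for [alpha] lies below [B] and below [B']. With equal arrivals the gap
    [B - C] is subinvariant, so [B] agrees with [C] and is itself below [B']. *)
Lemma flow_homo alpha alpha' B B' : (forall i, incr (alpha i)) ->
  (forall i, incr_le (alpha i) (alpha' i)) -> is_flow alpha B -> is_flow alpha' B' ->
  forall i, incr_le (B i) (B' i).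
Proof.
move=> ia aa' fB fB'; have [C fC leastC] := least_flow ia.
have lexx_ j : incr_le (alpha j) (alpha j) by exact: incr_le_refl.
have CB : forall i, incr_le (C i) (B i).
  apply: leastC => [|j]; first exact: fB.1.
  by apply: eq_incr (incr0 R) => t t0; rewrite -fB.2// subrr.
have CBE i t : 0 <= t -> B i t = C i t.
  move=> t0; apply/eqP; rewrite -subr_eq0; apply/eqP; move: i.
  apply: (subinvariant0 sP cP) => i; first exact: (CB i).1.
  have := flow_lip_of_le i ia lexx_ fC fB CB t0.
  by rewrite subrr add0r.
have CB' : forall i, incr_le (C i) (B' i).
  apply: leastC => [|j]; first exact: fB'.1.
  have : incr_le (thr (mu j) (inflow alpha B' j)) (thr (mu j) (inflow alpha' B' j)).
    apply: thr_homo => //; first by apply: inflow_incr => //; exact: fB'.1.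
    by apply: inflow_homo => // k; exact: incr_le_refl.
  by apply: eq_incr => t t0; rewrite -fB'.2.
by move=> i; apply: eq_incr (CB' i) => t t0; rewrite CBE.
Qed.

Lemma flow_lip alpha alpha' B B' i t : (forall i, incr (alpha i)) ->
  (forall i, incr_le (alpha i) (alpha' i)) -> is_flow alpha B -> is_flow alpha' B' ->
  0 <= t -> B' i t - B i t <= alpha' i t - alpha i t + \sum_j P j i * (B' j t - B j t).
Proof. by move=> ia aa' fB fB'; apply: flow_lip_of_le => //; exact: flow_homo fB fB'. Qed.

Lemma flow_unique alpha B B' i t : (forall i, incr (alpha i)) ->
  is_flow alpha B -> is_flow alpha B' -> 0 <= t -> B i t = B' i t.
Proof.
move=> ia fB fB' t0.
have lexx_ j : incr_le (alpha j) (alpha j) by exact: incr_le_refl.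
apply/le_anti; rewrite (incr_leP (flow_homo ia lexx_ fB fB' i))//=.
exact: (incr_leP (flow_homo ia lexx_ fB' fB i)).
Qed.

Lemma flow_rightc alpha B i : (forall i, incr (alpha i)) -> (forall i, rightc (mu i)) ->
  is_flow alpha B -> rightc (B i).
Proof.
move=> ia rmu fB; apply: rightc_incr_le (fB.1 i) _ (rmu i).
apply: eq_incr (reg_incr (mui i) (inflow_incr i ia fB.1)) => t t0.
by rewrite fB.2// /thr; lra.
Qed.

(** In either case [flow_lip] bounds the gap between flows by the gap between arrivals plus the
    routed image of the same gap, as [subinvariant_cvg0] requires. Decreasing arrivals serve right
    continuity in the level [x], increasing ones the limit [x -> oo]. *)
Lemma flow_cvg (an : nat -> 'I_K -> R -> R) (bn : nat -> 'I_K -> R -> R) alpha B t :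
  (forall n i, incr (an n i)) -> (forall i, incr (alpha i)) ->
  (forall n, is_flow (an n) (bn n)) -> is_flow alpha B -> 0 <= t ->
  (forall i, an n i t @[n --> \oo] --> alpha i t) ->
  ((forall n m i, (n <= m)%N -> incr_le (an n i) (an m i)) /\
    (forall n i, incr_le (an n i) (alpha i))) \/
  ((forall n m i, (n <= m)%N -> incr_le (an m i) (an n i)) /\
    (forall n i, incr_le (alpha i) (an n i))) ->
  forall i, bn n i t @[n --> \oo] --> B i t.
Proof.
move=> ian ia fn fB t0 cva [[mon le]|[mon le]] i.
- suff h : B i t - bn n i t @[n --> \oo] --> 0.
    rewrite -[X in _ --> X]subr0.
    rewrite (_ : (fun n => bn n i t) = (fun n => B i t - (B i t - bn n i t))).
      by apply: cvgB => //; exact: cvg_cst.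
    by apply/funext => n; lra.
  move: i; apply: (subinvariant_cvg0 sP cP (a := fun n i => alpha i t - an n i t)).
  + by move=> n i; exact: (flow_homo (ian n) (le n) (fn n) fB i).1.
  + move=> n m i nm; rewrite lerD2l lerN2.
    apply: incr_leP => //; exact: (flow_homo (ian n) (fun i => mon n m i nm) (fn n) (fn m)).
  + move=> n i; exact: flow_lip.
  + by move=> i; rewrite -(subrr (alpha i t)); apply: cvgB => //; exact: cvg_cst.
- suff h : bn n i t - B i t @[n --> \oo] --> 0.
    rewrite -[X in _ --> X]add0r.
    rewrite (_ : (fun n => bn n i t) = (fun n => (bn n i t - B i t) + B i t)).
      by apply: cvgD => //; exact: cvg_cst.
    by apply/funext => n; lra.
  move: i; apply: (subinvariant_cvg0 sP cP (a := fun n i => an n i t - alpha i t)).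
  + by move=> n i; exact: (flow_homo ia (le n) fB (fn n) i).1.
  + move=> n m i nm; rewrite lerD2r.
    apply: incr_leP => //; exact: (flow_homo (ian m) (fun i => mon n m i nm) (fn m) (fn n)).
  + move=> n i; exact: flow_lip.
  + by move=> i; rewrite -(subrr (alpha i t)); apply: cvgB => //; exact: cvg_cst.
Qed.

End network.

(** * Finite measures on the half line *)

Section half_line_measures.
Variable R : realType.
Local Notation T := (bR R).
Implicit Types (m : fmeas R) (f : R -> R) (x y : R).

Lemma RpE : (Rp (R:=R)) = `[0, +oo[%classic.
Proof. by rewrite set_itvcy. Qed.

Lemma measurable_Rp : measurable (Rp (R:=R) : set T).
Proof. by rewrite RpE; exact: measurable_itv. Qed.

Lemma measurable_lt0 : measurable ([set x : T | x < 0] : set T).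
Proof. by rewrite -set_itvNyo; exact: measurable_itv. Qed.

Lemma measurable_itvT (i : interval R) : measurable ([set` i] : set T).
Proof. exact: measurable_itv. Qed.
Hint Resolve measurable_Rp measurable_lt0 measurable_itvT : core.

Lemma mvE m (A : set T) : measurable A -> m A = (mv m A)%:E.
Proof. by move=> mA; rewrite /mv fineK// fin_num_measure. Qed.

Lemma mv_ge0 m (A : set T) : 0 <= mv m A.
Proof. exact: fine_ge0. Qed.

Lemma mv_le m (A B : set T) : measurable A -> measurable B -> A `<=` B -> mv m A <= mv m B.
Proof.
by move=> mA mB AB; rewrite -lee_fin -!mvE//; apply: le_measure => //; rewrite inE.
Qed.

Lemma mvU m (A B : set T) : measurable A -> measurable B -> A `&` B = set0 ->
  mv m (A `|` B) = mv m A + mv m B.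
Proof.
move=> mA mB AB; apply/EFin_inj; rewrite EFinD -!mvE//; last exact: measurableU.
by rewrite measureU.
Qed.

Lemma mv_oy m x : 0 <= x ->
  mv m `[0, +oo[%classic = mv m `[0, x]%classic + mv m `]x, +oo[%classic.
Proof.
move=> x0; rewrite -mvU//.
  by rewrite -itv_bndbnd_setU// ?bnd_simp.
by apply/seteqP; split=> // z [] /=; rewrite !in_itv/= andbT => /andP[_ zx]; rewrite ltNge zx.
Qed.

Lemma mv_Ny m x : onRp m -> mv m `]-oo, x]%classic = if x < 0 then 0 else mv m `[0, x]%classic.
Proof.
rewrite /onRp => m0; have [xlt0|x0] := ltP x 0.
  apply/le_anti; rewrite mv_ge0 andbT -lee_fin -mvE//.
  apply: (@le_trans _ _ (m [set z : T | z < 0])); last by rewrite m0.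
  apply: le_measure; rewrite ?inE// => z /=; rewrite in_itv/= => zx.
  exact: le_lt_trans xlt0.
have -> : `]-oo, x]%classic = [set z : R | z < 0] `|` `[0, x]%classic.
  by rewrite -set_itvNyo -itv_bndbnd_setU// ?bnd_simp.
rewrite mvU//.
  by rewrite /mv m0/= add0r.
by apply/seteqP; split=> // z [] /=; rewrite in_itv/= => + /andP[]; rewrite ltNge => /negP.
Qed.

Lemma mv_cvgy m : mv m `[0, n%:R]%classic @[n --> \oo] --> mv m `[0, +oo[%classic.
Proof.
apply: fine_cvg; rewrite -mvE//.
rewrite (_ : `[0, +oo[%classic = \bigcup_n `[0, n%:R]%classic).
  apply: nondecreasing_cvg_mu => //; first exact: bigcup_measurable.
  by move=> n p np; apply/subsetPset/subset_itvl; rewrite bnd_simp ler_nat.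
by rewrite itv_bndy_bigcup_BRight; apply: eq_bigcupr => n _; rewrite add0r.
Qed.

Lemma rightc_seq f : (forall s t, 0 <= s -> s <= t -> f s <= f t) ->
  (forall x, 0 <= x -> f (x + n.+1%:R^-1) @[n --> \oo] --> f x) -> rightc f.
Proof.
move=> fm fc x x0; apply/cvgrPdist_lt => e e0.
have /cvgrPdist_lt/(_ e e0)[n _ /(_ n (leqnn n)) hn] := fc x x0.
near=> y; have xy : x <= y by [].
rewrite distrC ger0_norm ?subr_ge0 ?fm//.
move: hn; rewrite distrC ger0_norm ?subr_ge0 ?fm ?lerDl ?invr_ge0// => hn.
apply: le_lt_trans hn; rewrite lerD2r fm ?(le_trans x0 xy)//.
near: y; apply: nbhs_right_le; by rewrite ltrDl invr_gt0.
Unshelve. all: by end_near. Qed.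

Lemma mv_incr m : incr (fun x => mv m `[0, x]%classic).
Proof.
split=> [t _|s t s0 st]; first exact: mv_ge0.
by apply: mv_le => //; apply: subset_itvl; rewrite bnd_simp.
Qed.

Lemma mv_rightc m : rightc (fun x => mv m `[0, x]%classic).
Proof.
apply: rightc_seq => [s t s0 st|x x0]; first exact: (mv_incr m).2.
apply: fine_cvg; rewrite -mvE//.
rewrite [X in m X](_ : _ = \bigcap_n `[0, x + n.+1%:R^-1]%classic).
  apply: nonincreasing_cvg_mu => //; last 2 first.
  - by apply: bigcap_measurable => // k _; exact: measurable_itvT.
  - move=> n p np; apply/subsetPset/subset_itvl; rewrite bnd_simp.
    by rewrite lerD2l lef_pV2 ?posrE// ler_nat.
  by rewrite -ge0_fin_numE// fin_num_measure.
apply/seteqP; split=> [z /= + n _ /=|z hz /=].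
  rewrite !in_itv/= => /andP[-> zx]/=; apply: (le_trans zx).
  by rewrite lerDl invr_ge0.
have := hz 0%N I; rewrite /= !in_itv/= => /andP[-> _]/=.
rewrite leNgt; apply/negP => /ltr_add_invr[k hk].
by have := hz k I; rewrite /= in_itv/= => /andP[_]; rewrite leNgt hk.
Qed.

(** Stated for measures finite on left half lines, because [rint_lincomb] applies it to sums of
    measures that are not packaged as [fmeas]. *)
Lemma measure_eq_cdf (m1 m2 : {measure set T -> \bar R}) :
  (forall x, m1 `]-oo, x]%classic = m2 `]-oo, x]%classic) ->
  (forall x, (m1 `]-oo, x]%classic < +oo)%E) ->
  forall A, measurable A -> m1 A = m2 A.
Proof.
move=> m12 fin1; have fin2 x : (m2 `]-oo, x]%classic < +oo)%E by rewrite -m12.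
have ocE a b : a <= b -> `]a, b]%classic = `]-oo, b] `\` `]-oo, a] :> set R.
  by move=> ab; rewrite -[RHS]setCK setCD setCitvl setUC -[LHS]setCK setCitv.
apply: (@measure_unique _ R T (@ocitv R : set (set T))
  (fun n => (`](- n%:R), n%:R]%classic : set T))) => //.
- exact: ocitvI.
- by move=> n; exact: is_ocitv.
- by apply/seteqP; split=> // x _; exists (Num.bound x) => //=;
    rewrite in_itv/= ltrNl ltrNbound ltW// ltr_bound.
- move=> _ [[a b] _ <-]/=; have [ab|ba] := leP a b; last first.
    by rewrite set_itv_ge ?measure0// bnd_simp -leNgt ltW.
  have D (m : {measure set T -> \bar R}) : (m `]-oo, b]%classic < +oo)%E ->
      m `]a, b]%classic = (m `]-oo, b]%classic - m `]-oo, a]%classic)%E.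
    move=> mfin; rewrite ocE// measureD// setIidr//.
    by apply: subset_itvl; rewrite bnd_simp.
  by rewrite !D// !m12.
- move=> k; apply: le_lt_trans (fin1 k%:R); apply: le_measure; rewrite ?inE//.
  exact: subset_itvr.
Qed.

Lemma fmeas_eq m1 m2 : onRp m1 -> onRp m2 ->
  (forall x, 0 <= x -> mv m1 `[0, x]%classic = mv m2 `[0, x]%classic) ->
  forall A, measurable A -> m1 A = m2 A.
Proof.
move=> o1 o2 m12; apply: measure_eq_cdf => x; last first.
  by rewrite -ge0_fin_numE// fin_num_measure.
have e m (om : onRp m) :
    m `]-oo, x]%classic = (if x < 0 then 0 else mv m `[0, x]%classic)%:E.
  by rewrite mvE// mv_Ny.
by rewrite [LHS](e m1 o1) [RHS](e m2 o2); case: ltP => // /m12 ->.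
Qed.

Lemma ext0_nd g : incr g -> forall x y, x <= y -> ext0 g x <= ext0 g y.
Proof.
move=> [g0 gm] x y xy; rewrite /ext0; have [x0|x0] := ltP x 0.
  by case: ltP => // /g0.
by rewrite ltNge (le_trans x0 xy)/= gm.
Qed.

Lemma ext0_rc g : rightc g -> forall x, ext0 g y @[y --> x^'+] --> ext0 g x.
Proof.
move=> rg x; have [x0|x0] := ltP x 0.
  apply: (@cvg_trans _ ((fun=> 0) y @[y --> x^'+])); last by rewrite /ext0 x0; exact: cvg_cst.
  apply: near_eq_cvg; near=> y; have y0 : y < 0 by near: y; exact: nbhs_right_lt.
  by rewrite /ext0 y0.
apply: (@cvg_trans _ (g y @[y --> x^'+])); last by rewrite /ext0 ltNge x0/=; exact: rg.
apply: near_eq_cvg; near=> y; have xy : x <= y by [].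
by rewrite /ext0 ltNge (le_trans x0 xy).
Unshelve. all: by end_near. Qed.

Lemma dmeas_oc (g : R -> R) (a b : R) : incr g -> rightc g -> a <= b ->
  dmeas g `]a, b]%classic = (ext0 g b - ext0 g a)%:E.
Proof.
move=> ig rg ab; rewrite /dmeas /lebesgue_stieltjes_measure /measure_extension/=.
rewrite measurable_mu_extE/=; last exact: is_ocitv.
(* The default branch of [cumul_part] is excluded: [ext0 g] is nondecreasing and right
   continuous. *)
rewrite wlength_itv_bnd//; congr (_ - _)%:E; rewrite /cumul_part; case: pselect => //;
  by case; split; [exact: ext0_nd|exact: ext0_rc].
Qed.

Lemma dmeas_Ny (g : R -> R) x : incr g -> rightc g -> dmeas g `]-oo, x]%classic = (ext0 g x)%:E.
Proof.
move=> ig rg.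
have h1 : dmeas g `](- n%:R), x]%classic @[n --> \oo] --> dmeas g `]-oo, x]%classic.
  rewrite itvNybndEbigcup; apply: nondecreasing_cvg_mu => //.
    exact: bigcup_measurable.
  by move=> *; apply/subsetPset/subset_itv; rewrite leBSide//= lerN2 ler_nat.
suff h2 : dmeas g `](- n%:R), x]%classic @[n --> \oo] --> (ext0 g x)%:E.
  exact: cvg_unique h1 h2.
apply: (@cvg_trans _ ((fun=> (ext0 g x)%:E) n @[n --> \oo])); last exact: cvg_cst.
apply: near_eq_cvg; near=> n; rewrite dmeas_oc//.
  rewrite {3}/ext0 ifT ?subr0// oppr_lt0 ltr0n; near: n; exact: nbhs_infty_gt.
by rewrite lerNl; near: n; exact: nbhs_infty_ger.
Unshelve. all: by end_near. Qed.

(** The measure is the Lebesgue-Stieltjes measure of [ext0 F], so that the value [F 0] becomes an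
    atom at 0. The measures [beta], [xi] and the left limits in time are all produced here. *)
Lemma fmeas_of_cdf (F : R -> R) (M : R) : incr F -> rightc F -> (forall x, 0 <= x -> F x <= M) ->
  exists2 m : fmeas R, onRp m & forall x, 0 <= x -> mv m `[0, x]%classic = F x.
Proof.
move=> iF rF FM.
have finT : (dmeas F setT <= M%:E)%E.
  have h1 : dmeas F `]-oo, n%:R]%classic @[n --> \oo] --> dmeas F setT.
    rewrite (_ : setT = \bigcup_n `]-oo, n%:R]%classic :> set T).
      apply: nondecreasing_cvg_mu => //; first exact: bigcup_measurable.
      by move=> *; apply/subsetPset/subset_itvl; rewrite bnd_simp ler_nat.
    apply/esym/seteqP; split=> // x _; exists (Num.bound x) => //=.
    by rewrite in_itv/= ltW// ltr_bound.
  rewrite -(cvg_lim _ h1)//; apply: lime_le; first by apply/cvg_ex; eexists; exact: h1.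
  apply: nearW => n; rewrite dmeas_Ny// lee_fin /ext0 ltNge ler0n/= FM//.
have fin : fin_num_fun (dmeas F : set T -> \bar R).
  move=> A mA; rewrite ge0_fin_numE//; apply: (le_lt_trans _ (ltry M)).
  by apply: le_trans finT; apply: le_measure => //; rewrite inE.
pose lsF := lebesgue_stieltjes_measure (cumul_part (ext0 F)).
pose m : fmeas R := HB.pack lsF (Measure_isFinite.Build _ T R lsF fin).
(* The negative axis is exhausted by half lines ending at [- 1/(n+1)], where [ext0 F] vanishes; a
   half line closed at 0 would include the atom. *)
have om : onRp m.
  apply/negligibleP => //; apply: (@negligibleS _ _ _ m
    (\bigcup_n (`]-oo, (- n.+1%:R^-1)]%classic : set T))).
    move=> x /= x0; have /ltr_add_invr[k] : 0 < - x by rewrite oppr_gt0.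
    by rewrite add0r => hk; exists k => //=; rewrite in_itv/= lerNr ltW.
  apply: negligible_bigcup => n; apply/negligibleP => //.
  have := dmeas_Ny (- n.+1%:R^-1) iF rF.
  by rewrite /ext0 oppr_lt0 invr_gt0 ltr0n.
exists m => // x x0.
have := mv_Ny x om; rewrite ltNge x0/= => <-.
by have := congr1 fine (dmeas_Ny x iF rF); rewrite /= /ext0 ltNge x0.
Qed.

End half_line_measures.

(** * Integrals of bounded continuous functions *)

Section integrals.
Variable R : realType.
Local Notation T := (bR R).
Implicit Types (m : fmeas R) (f : R -> R) (x y : R).
Local Hint Resolve measurable_Rp measurable_lt0 measurable_itvT : core.

Definition rint m f := fine (mint m f).

Lemma cb_measurable f : cb f -> measurable_fun (Rp (R:=R) : set T) f.
Proof.
move=> [cf _]; apply: subspace_continuous_measurable_fun; last exact: cf.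
exact: measurable_Rp.
Qed.

Lemma cb_integrable m f : cb f -> m.-integrable (Rp (R:=R) : set T) (EFin \o f).
Proof.
move=> cf; apply: measurable_bounded_integrable => //.
- by rewrite -ge0_fin_numE// fin_num_measure.
- exact: cb_measurable.
- case: cf => _ [M fM]; exists M; split; first exact: num_real.
  by move=> N MN x x0; apply: le_trans (fM x x0) (ltW MN).
Qed.

Lemma rintE m f : cb f -> mint m f = (rint m f)%:E.
Proof.
by move=> cf; rewrite /rint fineK//; apply: integrable_fin_num => //; exact: cb_integrable.
Qed.

Lemma cb_cst (c : R) : cb (fun=> c).
Proof. by split; [move=> x; exact: cvg_cst|exists `|c|]. Qed.

Lemma cb_continuous f M : continuous f -> (forall x, `|f x| <= M) -> cb f.
Proof. by move=> cf fM; split; [exact: continuous_subspaceT|exists M => x _; exact: fM]. Qed.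

Lemma rint_cst m (c : R) : rint m (fun=> c) = c * mv m `[0, +oo[%classic.
Proof.
by rewrite /rint /mint integral_cst// -RpE/= mvE.
Qed.

Lemma cbDcst f (c : R) : cb f -> cb (fun x => f x + c).
Proof.
move=> [cf [M fM]]; split.
  by move=> x; apply: cvgD; [exact: cf|exact: cvg_cst].
by exists (M + `|c|) => x x0; apply: le_trans (ler_normD _ _) _; rewrite lerD2r fM.
Qed.

Lemma rintDcst m f (c : R) : cb f ->
  rint m (fun x => f x + c) = rint m f + c * mv m `[0, +oo[%classic.
Proof.
move=> cf; rewrite -rint_cst; apply: EFin_inj.
rewrite EFinD -!rintE//; [|exact: cb_cst|exact: cbDcst].
rewrite /mint -integralD//; [exact: cb_integrable|].
exact: (cb_integrable m (cb_cst c)).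
Qed.

Lemma rint_ge0 m f : (forall x, 0 <= x -> 0 <= f x) -> 0 <= rint m f.
Proof. by move=> f0; apply/fine_ge0/integral_ge0 => x x0; rewrite lee_fin f0. Qed.

Lemma rint_norm m f (M : R) : cb f -> (forall x, 0 <= x -> `|f x| <= M) ->
  `|rint m f| <= M * mv m `[0, +oo[%classic.
Proof.
move=> cf fM.
have h1 : 0 <= rint m (fun x => f x + M).
  by apply: rint_ge0 => x x0; have := fM x x0; rewrite ler_norml; lra.
have cNf : cb (fun x => - f x).
  case: cf => cf _; split; first by move=> x; apply: cvgN; exact: cf.
  by exists M => x x0; rewrite normrN fM.
have h2 : 0 <= rint m (fun x => - f x + M).
  by apply: rint_ge0 => x x0; have := fM x x0; rewrite ler_norml; lra.
rewrite !rintDcst// in h1 h2.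
have hN : rint m (fun x => - f x) = - rint m f.
  apply: EFin_inj; rewrite EFinN -!rintE// /mint -integralN//.
  exact/integrable_add_def/cb_integrable.
by rewrite hN in h2; rewrite ler_norml; lra.
Qed.

(** This carries condition (1) from intervals [[0, x]] to test functions. The subtracted measure [n]
    stands on the left so that both sides are positive measures, determined by their distribution
    functions. *)
Lemma rint_lincomb (K : nat) m n a (b : 'I_K -> fmeas R) (c : 'I_K -> R) f :
  (forall j, 0 <= c j) -> onRp m -> onRp n -> onRp a -> (forall j, onRp (b j)) ->
  (forall x, 0 <= x -> mv m `[0, x]%classic + mv n `[0, x]%classic =
     mv a `[0, x]%classic + \sum_j c j * mv (b j) `[0, x]%classic) ->
  cb f -> rint m f + rint n f = rint a f + \sum_j c j * rint (b j) f.
Proof.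
move=> c0 om on oa ob eqc.
(* [msum] sums a family indexed by naturals, so the family over ['I_K] is extended by the zero
   measure. *)
pose bb (k : nat) : {measure set T -> \bar R} :=
  if insub k is Some j
  then [the {measure set T -> \bar R} of mscale (NngNum (c0 j)) (b j)]
  else [the {measure set T -> \bar R} of mzero].
pose m1 := measure_add m n.
pose m2 := measure_add a (msum bb K).
have bbE (j : 'I_K) : bb j = mscale (NngNum (c0 j)) (b j) :> (set T -> \bar R).
  rewrite /bb; case: insubP => [i _ /val_inj <-//|]; by rewrite ltn_ord.
have m1E A : measurable A -> m1 A = (mv m A + mv n A)%:E.
  by move=> mA; rewrite /m1 measure_addE EFinD -!mvE.
have m2E A : measurable A -> m2 A = (mv a A + \sum_j c j * mv (b j) A)%:E.
  move=> mA; rewrite /m2 measure_addE EFinD -mvE//; congr (_ + _)%E.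
  rewrite /msum -sumEFin; apply: eq_bigr => j _.
  by rewrite bbE /mscale/= EFinM -mvE.
have m12 A : measurable A -> m1 A = m2 A.
  apply: measure_eq_cdf => x; last by rewrite [ltLHS]m1E// ltry.
  rewrite [LHS]m1E// [RHS]m2E// !mv_Ny//.
  under eq_bigr do rewrite mv_Ny//.
  case: ltP => x0; last by rewrite eqc.
  by rewrite big1 ?addr0// => j _; rewrite mulr0.
(* Additivity in the measure is available for nonnegative integrands; a general [f] with [|f| <= M]
   is then reached by subtracting the identity for the constant [M] from the one for [f + M]. *)
have pos (g : R -> R) : (forall x, 0 <= x -> 0 <= g x) -> cb g ->
    rint m g + rint n g = rint a g + \sum_j c j * rint (b j) g.
  move=> g0 cg; have mg := cb_measurable cg.
  have mEg : measurable_fun (Rp (R:=R) : set T) (EFin \o g) by exact/measurable_EFinP.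
  have Eg0 x : Rp x -> (0 <= (EFin \o g) x)%E by move=> x0; rewrite lee_fin g0.
  have : (\int[m1]_(x in (Rp (R:=R) : set T)) (EFin \o g) x =
          \int[m2]_(x in (Rp (R:=R) : set T)) (EFin \o g) x)%E.
    by apply: eq_measure_integral => A mA _; exact: m12.
  rewrite !ge0_integral_measure_add// ge0_integral_measure_sum//.
  under [X in _ = (_ + X)%E -> _]eq_bigr => j _.
    rewrite (_ : (\int[bb j]_(x in _) _)%E = (c j * rint (b j) g)%:E); last first.
      rewrite (eq_measure_integral (mscale (NngNum (c0 j)) (b j))); last first.
        by move=> A _ _; exact: (congr1 (fun h => h A) (bbE j)).
      rewrite ge0_integral_mscale//=; first by rewrite EFinM -rintE.
      exact: measurable_Rp.
    over.
  have e (p : fmeas R) :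
      (\int[p]_(x in (Rp (R:=R) : set T)) (EFin \o g) x = (rint p g)%:E)%E by exact: rintE.
  by rewrite sumEFin !e -!EFinD; case.
move=> cf; have [_ [M fM]] := cf.
have h1 : rint m (fun x => f x + M) + rint n (fun x => f x + M) =
    rint a (fun x => f x + M) + \sum_j c j * rint (b j) (fun x => f x + M).
  apply: pos; last exact: cbDcst.
  by move=> x x0; have := fM x x0; rewrite ler_norml; lra.
have M0 : 0 <= M by exact: le_trans (fM 0 (lexx _)).
have h2 := pos (fun=> M) (fun _ _ => M0) (cb_cst M).
rewrite !rintDcst// in h1; rewrite !rint_cst in h2.
move: h1 h2; under eq_bigr do rewrite rintDcst// mulrDr.
under [X in _ -> _ = _ + X -> _]eq_bigr do rewrite rint_cst.
rewrite big_split/=; lra.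
Qed.

End integrals.

(** * Masses of intervals along nondecreasing measure paths *)

Section monotone_measures.
Variable R : realType.
Local Notation T := (bR R).
Implicit Types (m : fmeas R) (f : R -> R) (x y : R).
Local Hint Resolve measurable_Rp measurable_lt0 measurable_itvT : core.

(** Continuous cut-off: 1 up to [x], then linear down to 0 at [x + 1/(n+1)]. It decreases to the
    indicator of []-oo, x]]. *)
Definition ramp x (n : nat) (u : R) : R := Num.min 1 (Num.max 0 (1 - n.+1%:R * (u - x))).

Lemma ramp_ge0 x n u : 0 <= ramp x n u.
Proof. by rewrite /ramp le_min ler01 le_max lexx. Qed.

Lemma ramp_le1 x n u : ramp x n u <= 1.
Proof. by rewrite /ramp ge_min lexx. Qed.

Lemma ramp_homo x y n u : x <= y -> ramp x n u <= ramp y n u.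
Proof.
move=> xy; apply: le_min2 => //; apply: le_max2 => //.
by rewrite lerD2l lerN2 ler_wpM2l// lerD2l lerN2.
Qed.

Lemma ramp_continuous x n : continuous (ramp x n).
Proof.
move=> u.
apply: (@continuous_min _ _ (fun=> 1) (fun u => Num.max 0 (1 - n.+1%:R * (u - x))) u).
  exact: cvg_cst.
apply: (@continuous_max _ _ (fun=> 0) (fun u => 1 - n.+1%:R * (u - x)) u).
  exact: cvg_cst.
apply: cvgB; first exact: cvg_cst.
by apply: cvgMr; apply: cvgB; [exact: cvg_id|exact: cvg_cst].
Qed.

Lemma cb_ramp x n : cb (ramp x n).
Proof.
apply: (@cb_continuous _ _ 1); first exact: ramp_continuous.
by move=> u; rewrite ger0_norm ?ramp_ge0// ramp_le1.
Qed.

Lemma cbB f g : cb f -> cb g -> cb (fun x => f x - g x).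
Proof.
move=> [cf [M fM]] [cg [N gN]]; split.
  by move=> x; apply: cvgB; [exact: cf|exact: cg].
by exists (M + N) => x x0; apply: le_trans (ler_normB _ _) _; rewrite lerD ?fM ?gN.
Qed.

Lemma rintB m f g : cb f -> cb g -> rint m (fun x => f x - g x) = rint m f - rint m g.
Proof.
move=> cf cg; apply: EFin_inj.
rewrite EFinB -!rintE//; last exact: cbB.
by rewrite /mint -integralB_EFin//; exact: cb_integrable.
Qed.

Lemma rint_ramp x n m : 0 <= x ->
  mv m `[0, x]%classic <= rint m (ramp x n) <= mv m `[0, x + n.+1%:R^-1]%classic.
Proof.
move=> x0.
have indE z : 0 <= z ->
    (\int[m]_(u in (Rp (R:=R) : set T)) (\1_(`[0%R, z]%classic : set T) u)%:E
      = (mv m `[0%R, z]%classic)%:E)%E.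
  move=> z0; rewrite integral_indic// setIidl; first exact: mvE.
  by move=> u /=; rewrite in_itv/= => /andP[].
have mr : measurable_fun (Rp (R:=R) : set T) (EFin \o ramp x n).
  by apply/measurable_EFinP; apply: cb_measurable; exact: cb_ramp.
have xn0 : 0 <= x + n.+1%:R^-1 by rewrite addr_ge0// invr_ge0.
rewrite -!lee_fin -!indE// -rintE; last exact: cb_ramp.
apply/andP; split; apply: ge0_le_integral => //.
- by apply/measurable_EFinP; exact: measurable_indic.
- move=> u _; rewrite lee_fin indicE; case: (boolP (u \in _)) => [|_]; last exact: ramp_ge0.
  rewrite inE/= in_itv/= => /andP[_ ux]; rewrite /ramp le_min lexx/= le_max.
  by rewrite lerDl oppr_ge0 mulr_ge0_le0// ?orbT// subr_le0.
- by move=> u _; rewrite lee_fin ramp_ge0.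
- by apply/measurable_EFinP; exact: measurable_indic.
- move=> u u0; rewrite lee_fin indicE; case: (boolP (u \in _)) => [_|]; first exact: ramp_le1.
  rewrite notin_setE/= in_itv/= => /negP; rewrite negb_and.
  rewrite (_ : (0 <= u) = true)//= -ltNge => xu.
  rewrite /ramp ge_min; apply/orP; right; rewrite ge_max lexx/= subr_le0.
  by rewrite -ler_pdivrMl// mulr1 lerBrDl ltW.
Qed.

Lemma rint_ramp_cvg x m : 0 <= x ->
  rint m (ramp x n) @[n --> \oo] --> mv m `[0, x]%classic.
Proof.
move=> x0; apply: (@squeeze_cvgr _ _ _ _ (fun=> mv m `[0, x]%classic)
   (fun n => mv m `[0, x + n.+1%:R^-1]%classic)).
- by apply: nearW => n; exact: rint_ramp.
- exact: cvg_cst.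
- have /cvg_at_rightP := @mv_rightc R m x x0; apply; split.
    by move=> n; rewrite ltrDl invr_gt0.
  rewrite -[X in _ --> X]addr0; apply: cvgD; first exact: cvg_cst.
  exact: cvg_harmonic.
Qed.

Arguments rint_ramp_cvg [x] m _.

Definition cble m m' :=
  forall f, cb f -> (forall x, 0 <= x -> 0 <= f x) -> rint m f <= rint m' f.

Lemma cble_total m m' : cble m m' -> mv m `[0, +oo[%classic <= mv m' `[0, +oo[%classic.
Proof.
by move=> /(_ (fun=> 1) (cb_cst 1) (fun _ _ => ler01)); rewrite !rint_cst !mul1r.
Qed.

Lemma cble_cc m m' x : cble m m' -> 0 <= x ->
  mv m `[0, x]%classic <= mv m' `[0, x]%classic.
Proof.
move=> mm x0; apply: (ler_cvg_to (rint_ramp_cvg m x0) (rint_ramp_cvg m' x0)).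
by apply: nearW => n; apply: mm; [exact: cb_ramp|move=> u _; exact: ramp_ge0].
Qed.

(** The difference of the ramps at [y] and [x] is a nonnegative test function approximating the
    indicator of []x, y]]. *)
Lemma cble_oc m m' x y : cble m m' -> 0 <= x -> x <= y ->
  mv m `[0, y]%classic - mv m `[0, x]%classic <= mv m' `[0, y]%classic - mv m' `[0, x]%classic.
Proof.
move=> mm x0 xy; have y0 := le_trans x0 xy.
apply: (ler_cvg_to (cvgB (rint_ramp_cvg m y0) (rint_ramp_cvg m x0))
   (cvgB (rint_ramp_cvg m' y0) (rint_ramp_cvg m' x0))).
apply: nearW => n; change (rint m (ramp y n) - rint m (ramp x n) <=
  rint m' (ramp y n) - rint m' (ramp x n)).
rewrite -!rintB; try exact: cb_ramp.
apply: mm; first by apply: cbB; exact: cb_ramp.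
by move=> u _; rewrite subr_ge0 ramp_homo.
Qed.

Lemma cble_oy m m' x : cble m m' -> 0 <= x ->
  mv m `]x, +oo[%classic <= mv m' `]x, +oo[%classic.
Proof.
move=> mm x0.
suff : mv m `[0, +oo[%classic - mv m `[0, x]%classic
    <= mv m' `[0, +oo[%classic - mv m' `[0, x]%classic by rewrite !(mv_oy _ x0); lra.
have h p : mv p `[0, +oo[%classic - rint p (ramp x n) @[n --> \oo] -->
    mv p `[0, +oo[%classic - mv p `[0, x]%classic.
  by apply: cvgB; [exact: cvg_cst|exact: rint_ramp_cvg].
apply: (ler_cvg_to (h m : _ @[n --> \oo] --> _) (h m')); apply: nearW => n.
have e p : mv p `[0, +oo[%classic = rint p (fun=> 1) by rewrite rint_cst mul1r.
change (mv m `[0, +oo[%classic - rint m (ramp x n) <=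
  mv m' `[0, +oo[%classic - rint m' (ramp x n)).
rewrite !e -!rintB; try exact: cb_ramp; try exact: cb_cst.
apply: mm; first by apply: cbB; [exact: cb_cst|exact: cb_ramp].
by move=> u _; rewrite subr_ge0 ramp_le1.
Qed.

Lemma DMup_cble (z : R -> fmeas R) s t : DMup z -> 0 <= s -> s <= t -> cble (z s) (z t).
Proof.
move=> [_ zm] s0 st f cf f0; have := zm f cf f0 s t s0 st.
by rewrite !rintE// lee_fin.
Qed.

Lemma cvg_rint (F : set_system R) (z : R -> fmeas R) (m : fmeas R) f : Filter F -> cb f ->
  (mint (z s) f @[s --> F] --> mint m f) <-> (rint (z s) f @[s --> F] --> rint m f).
Proof.
move=> FF cf; rewrite rintE//; split; first exact: fine_cvg.
by move=> h; apply/fine_cvgP; split=> //; apply: nearW => s; rewrite rintE.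
Qed.

Lemma DMup_total_rightc (z : R -> fmeas R) : DMup z ->
  rightc (fun t => mv (z t) `[0, +oo[%classic).
Proof.
move=> [[_ [zr _]] _] t t0.
have := zr t t0 (fun=> 1) (cb_cst 1) => /(cvg_rint _ _ _ (cb_cst 1)).
by under eq_fun do rewrite rint_cst mul1r; rewrite rint_cst mul1r.
Qed.

Lemma DMup_total_incr (z : R -> fmeas R) : DMup z ->
  incr (fun t => mv (z t) `[0, +oo[%classic).
Proof.
move=> zM; split=> [t _|s t s0 st]; first exact: mv_ge0.
exact/cble_total/DMup_cble.
Qed.

Lemma DMup_cc_incr (z : R -> fmeas R) x : DMup z -> 0 <= x ->
  incr (fun t => mv (z t) `[0, x]%classic).
Proof.
move=> zM x0; split=> [t _|s t s0 st]; first exact: mv_ge0.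
by apply: cble_cc => //; exact: DMup_cble.
Qed.

Lemma DMup_oy_incr (z : R -> fmeas R) x : DMup z -> 0 <= x ->
  incr (fun t => mv (z t) `]x, +oo[%classic).
Proof.
move=> zM x0; split=> [t _|s t s0 st]; first exact: mv_ge0.
by apply: cble_oy => //; exact: DMup_cble.
Qed.

Lemma DMup_cc_incr_le (z : R -> fmeas R) x y : DMup z -> 0 <= x -> x <= y ->
  incr_le (fun t => mv (z t) `[0, x]%classic) (fun t => mv (z t) `[0, y]%classic).
Proof.
move=> zM x0 xy; split=> [t _|s t s0 st].
  by rewrite subr_ge0; exact: (mv_incr (z t)).2.
by apply: cble_oc => //; exact: DMup_cble.
Qed.

Lemma DMup_cc_total_incr_le (z : R -> fmeas R) x : DMup z -> 0 <= x ->
  incr_le (fun t => mv (z t) `[0, x]%classic) (fun t => mv (z t) `[0, +oo[%classic).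
Proof.
move=> zM x0; apply: eq_incr (DMup_oy_incr zM x0) => t _.
by rewrite (mv_oy _ x0); lra.
Qed.

(** Weak convergence alone does not control the mass of [[0, x]] when [x] may carry an atom. Here
    the masses of [[0, x]] and []x, +oo[] are both nondecreasing in time and their sum is right
    continuous. *)
Lemma DMup_cc_rightc (z : R -> fmeas R) x : DMup z -> 0 <= x ->
  rightc (fun t => mv (z t) `[0, x]%classic).
Proof.
move=> zM x0; apply: rightc_incr_le (DMup_total_rightc zM).
  exact: DMup_cc_incr.
exact: DMup_cc_total_incr_le.
Qed.

Lemma DMup_oy_rightc (z : R -> fmeas R) x : DMup z -> 0 <= x ->
  rightc (fun t => mv (z t) `]x, +oo[%classic).
Proof.
move=> zM x0; apply: rightc_incr_le (DMup_total_rightc zM).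
  exact: DMup_oy_incr.
by apply: eq_incr (DMup_cc_incr zM x0) => t _; rewrite (mv_oy _ x0); lra.
Qed.

End monotone_measures.

(** * Measure paths built from distribution functions *)

Section measure_paths.
Variable R : realType.
Local Notation T := (bR R).
Implicit Types (m : fmeas R) (f : R -> R) (x y : R) (z : R -> fmeas R).

Definition cdf0 m x := mv m `[0, x]%classic.
Definition tot m := mv m `[0, +oo[%classic.

Lemma rintT m : rint m (fun=> 1) = tot m.
Proof. by rewrite rint_cst mul1r. Qed.

Lemma cdf0_le_tot m x : 0 <= x -> cdf0 m x <= tot m.
Proof. by move=> x0; rewrite /tot (mv_oy _ x0) lerDl mv_ge0. Qed.

Lemma rint_sub m m' : onRp m -> onRp m' -> incr_le (cdf0 m) (cdf0 m') ->
  exists d : fmeas R, forall f, cb f -> rint m' f = rint m f + rint d f.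
Proof.
move=> om om' le.
have [|x x0|d od dE] := @fmeas_of_cdf R _ (tot m') le.
- by move=> x x0; apply: cvgB; exact: mv_rightc.
- have := cdf0_le_tot m' x0; have : 0 <= cdf0 m x by exact: mv_ge0.
  by rewrite /cdf0; lra.
exists d => f cf.
(* With [K = 0] the sum is empty and the identity reads [m + d = m']; the family and the
   coefficients are dummies. *)
have := @rint_lincomb R 0 m d m' (fun=> m) (fun=> 0) f (fun=> lexx 0) om od om' (fun=> om).
rewrite big_ord0 addr0 => -> // x x0.
by rewrite big_ord0 addr0 dE//; rewrite /cdf0; lra.
Qed.

Lemma rint_sub_norm m m' f (M : R) : onRp m -> onRp m' -> incr_le (cdf0 m) (cdf0 m') ->
  cb f -> (forall x, 0 <= x -> `|f x| <= M) ->
  `|rint m' f - rint m f| <= M * (tot m' - tot m).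
Proof.
move=> om om' le cf fM; have [d dE] := rint_sub om om' le.
have := rint_norm d cf fM; rewrite -/(tot d).
have := dE _ (cb_cst 1); rewrite !rintT dE// => ->.
have e (u v : R) : u + v - u = v by lra.
by rewrite !e.
Qed.

(** The difference of two ordered measures is a positive measure, so it integrates [f] to at most
    [M] times its mass: convergence of total masses settles all test functions at once. *)
Lemma cvg_rint_of_tot (F : set_system R) z m f : Filter F -> cb f ->
  onRp m -> (\forall s \near F, onRp (z s)) ->
  (\forall s \near F, incr_le (cdf0 (z s)) (cdf0 m)) \/
  (\forall s \near F, incr_le (cdf0 m) (cdf0 (z s))) ->
  tot (z s) @[s --> F] --> tot m -> rint (z s) f @[s --> F] --> rint m f.
Proof.
move=> FF cf om oz le ct; have [_ [M fM]] := cf.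
have c0 : M * `|tot m - tot (z s)| @[s --> F] --> 0.
  rewrite -(mulr0 M); apply: cvgMr; rewrite -[X in _ --> X](@normr0 _ R).
  apply: cvg_norm; rewrite -(subrr (tot m)); apply: cvgB => //; exact: cvg_cst.
have bnd : \forall s \near F, `|rint m f - rint (z s) f| <= M * `|tot m - tot (z s)|.
  case: le => le; near=> s.
  - have l : incr_le (cdf0 (z s)) (cdf0 m) by near: s.
    have o : onRp (z s) by near: s.
    apply: le_trans (rint_sub_norm o om l cf fM) _.
    by rewrite ler_wpM2l ?ler_norm// (le_trans _ (fM 0 (lexx _))).
  - have l : incr_le (cdf0 m) (cdf0 (z s)) by near: s.
    have o : onRp (z s) by near: s.
    rewrite distrC (distrC (tot m)).
    apply: le_trans (rint_sub_norm om o l cf fM) _.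
    by rewrite ler_wpM2l ?ler_norm// (le_trans _ (fM 0 (lexx _))).
have : rint m f - rint (z s) f @[s --> F] --> 0.
  apply/norm_cvg0P; apply: squeeze_cvgr (cvg_cst 0) c0.
  by apply: filterS bnd => s ->; rewrite normr_ge0.
move=> h; rewrite -[X in _ --> X]subr0.
rewrite (_ : (fun s => rint (z s) f) = (fun s => rint m f - (rint m f - rint (z s) f))).
  by apply: cvgB => //; exact: cvg_cst.
by apply/funext => s; lra.
Unshelve. all: by end_near. Qed.

(** One level [N] carrying almost all the mass of [m] gives the lower bound on [tot (z s)];
    domination by [m] gives the upper one, ruling out extra mass near infinity. *)
Lemma cvg_tot_cdf0 (F : set_system R) z m : ProperFilter F ->
  (\forall s \near F, incr_le (cdf0 (z s)) (cdf0 m)) ->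
  (forall x, 0 <= x -> cdf0 (z s) x @[s --> F] --> cdf0 m x) ->
  tot (z s) @[s --> F] --> tot m.
Proof.
move=> FF le cv; apply/cvgrPdist_le => e e0.
have e20 : 0 < e / 2 by rewrite divr_gt0.
have /cvgrPdist_le/(_ _ e20)[N _ /(_ N (leqnn N))] := @mv_cvgy R m.
rewrite -/(tot m) -/(cdf0 m _) => hN.
have /cvgrPdist_le/(_ _ e20) hc := cv N%:R (ler0n _ _).
near=> s; have l : incr_le (cdf0 (z s)) (cdf0 m) by near: s.
have totle : tot (z s) <= tot m.
  apply: (ler_cvg_to (@mv_cvgy R (z s)) (@mv_cvgy R m)).
  by apply: nearW => n; exact: (incr_leP l).
have : `|cdf0 m N%:R - cdf0 (z s) N%:R| <= e / 2 by near: s.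
have h2 := cdf0_le_tot (z s) (ler0n R N); move: hN.
rewrite ger0_norm ?subr_ge0 ?cdf0_le_tot// => h1.
rewrite ger0_norm; last exact: l.1.
by rewrite ger0_norm ?subr_ge0//; lra.
Unshelve. all: by end_near. Qed.

(** The distribution function of [nu] is the supremum over [s < t]. A supremum need not be right
    continuous in [x]; this one is, because its increments are dominated by those of [z t]. *)
Lemma left_limit_fmeas z t : 0 < t -> (forall s, 0 <= s -> onRp (z s)) ->
  (forall s r, 0 <= s -> s <= r -> incr_le (cdf0 (z s)) (cdf0 (z r))) ->
  exists nu : fmeas R, [/\ onRp nu,
    (forall s, 0 <= s -> s < t -> incr_le (cdf0 (z s)) (cdf0 nu)) &
    tot (z s) @[s --> t^'-] --> tot nu].
Proof.
move=> t0 oz le; have t0' := ltW t0.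
pose S x := [set cdf0 (z s) x | s in [set s | 0 <= s < t]].
pose G x := sup (S x).
have ubS x : 0 <= x -> has_ubound (S x).
  move=> x0; exists (cdf0 (z t) x) => _ [s /= /andP[s0 st] <-].
  by apply: incr_leP => //; apply: le => //; exact: ltW.
have S0 x : S x !=set0 by exists (cdf0 (z 0) x), 0 => //=; rewrite lexx.
have ubG s x : 0 <= x -> 0 <= s -> s < t -> cdf0 (z s) x <= G x.
  by move=> x0 s0 st; apply: ub_le_sup; [exact: ubS|exists s => //=; rewrite s0].
have zG s : 0 <= s -> s < t -> incr_le (cdf0 (z s)) G.
  move=> s0 st; split=> [x x0|x y x0 xy]; first by rewrite subr_ge0 ubG.
  have y0 := le_trans x0 xy.
  suff : G x <= G y - (cdf0 (z s) y - cdf0 (z s) x) by lra.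
  apply: ge_sup => // _ [r /= /andP[r0 rt] <-].
  have [sr|rs] := leP s r.
    by have := (le s r s0 sr).2 x y x0 xy; have := ubG r y y0 r0 rt; lra.
  by have := incr_leP (le r s r0 (ltW rs)) x0; have := ubG s y y0 s0 st; lra.
have Gz : incr_le G (cdf0 (z t)).
  split=> [x x0|x y x0 xy].
    rewrite subr_ge0; apply: ge_sup => // _ [r /= /andP[r0 rt] <-].
    by apply: incr_leP => //; apply: le => //; exact: ltW.
  have y0 := le_trans x0 xy.
  suff : G y <= G x + (cdf0 (z t) y - cdf0 (z t) x) by lra.
  apply: ge_sup => // _ [r /= /andP[r0 rt] <-].
  by have := (le r t r0 (ltW rt)).2 x y x0 xy; have := ubG r x x0 r0 rt; lra.
have iG : incr G by apply: incr_le_incr (zG 0 (lexx _) t0); exact: mv_incr.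
have rG : rightc G by apply: rightc_incr_le iG Gz _; exact: mv_rightc.
have [|nu onu nuE] := @fmeas_of_cdf R G (tot (z t)) iG rG.
  by move=> x x0; apply: le_trans (incr_leP Gz x0) _; exact: cdf0_le_tot.
have znu s : 0 <= s -> s < t -> incr_le (cdf0 (z s)) (cdf0 nu).
  by move=> s0 st; apply: eq_incr (zG s s0 st) => x x0; rewrite /cdf0 nuE.
exists nu; split => //; apply: cvg_tot_cdf0.
  near=> s; apply: znu; last by [].
  by near: s; exact: nbhs_left_ge.
move=> x x0; apply/cvgrPdist_le => e e0.
have [_ [r /= /andP[r0 rt] <-] hr] : exists2 u, S x u & G x - e < u.
  by apply: sup_gt => //; rewrite -/(G x); lra.
near=> s; have s0 : 0 <= s by near: s; exact: nbhs_left_ge.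
have rs : r <= s by near: s; exact: nbhs_left_ge.
have st : s < t by [].
have h1 := incr_leP (le r s r0 rs) x0.
rewrite /cdf0 nuE// -/(cdf0 _ _) ger0_norm ?subr_ge0 ?ubG//.
by lra.
Unshelve. all: by end_near. Qed.

(** Order in time, including increments in [x], reduces weak right continuity to that of the total
    mass and makes left limits automatic. *)
Lemma DMup_of_cdf0 z : (forall s, 0 <= s -> onRp (z s)) ->
  (forall s r, 0 <= s -> s <= r -> incr_le (cdf0 (z s)) (cdf0 (z r))) ->
  rightc (fun s => tot (z s)) -> DMup z.
Proof.
move=> oz le rt; split; first split=> //; first split.
- move=> t t0 f cf; apply/cvg_rint => //; apply: cvg_rint_of_tot => //.
  + exact: oz.
  + near=> s; apply: oz; apply: (le_trans t0); exact: ltW.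
  + by right; near=> s; apply: le => //; exact: ltW.
  + exact: rt.
- move=> t t0; have [nu [onu le_nu cv]] := left_limit_fmeas t0 oz le.
  exists nu; split=> // f cf; apply/cvg_rint => //; apply: cvg_rint_of_tot => //.
  + by near=> s; apply: oz; near: s; exact: nbhs_left_ge.
  + by left; near=> s; apply: le_nu => //; near: s; exact: nbhs_left_ge.
- move=> f cf f0 s t s0 st; rewrite !rintE// lee_fin.
  have [d ->] := rint_sub (oz s s0) (oz t (le_trans s0 st)) (le s t s0 st) => //.
  by rewrite lerDl rint_ge0.
Unshelve. all: by end_near. Qed.

(** Convergence holds even at atoms of [nu]: monotonicity puts the masses of [[0, x]] and []x, +oo[]
    below those of [nu], while their sum converges to the total mass of [nu]. *)
Lemma DMup_left_cdf0 z t (nu : fmeas R) x : DMup z -> 0 < t -> 0 <= x ->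
  (forall f, cb f -> mint (z s) f @[s --> t^'-] --> mint nu f) ->
  cdf0 (z s) x @[s --> t^'-] --> cdf0 nu x.
Proof.
move=> zM t0 x0 cv.
have cv' f (cf : cb f) : rint (z s) f @[s --> t^'-] --> rint nu f.
  by apply/cvg_rint => //; exact: cv.
have ble s : 0 <= s -> s < t -> cble (z s) nu.
  move=> s0 st f cf f0; apply: (ler_cvg_to (cvg_cst _) (cv' f cf)).
  near=> r; apply: (DMup_cble zM) => //.
  by near: r; exact: nbhs_left_ge.
have ct : tot (z s) @[s --> t^'-] --> tot nu.
  have := cv' _ (cb_cst 1); rewrite rintT.
  by under eq_fun do rewrite rintT.
apply: (@squeeze_cvgr _ _ _ _ (fun s => cdf0 nu x - (tot nu - tot (z s))) (fun=> cdf0 nu x)).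
- near=> s; have s0 : 0 <= s by near: s; exact: nbhs_left_ge.
  have st : s < t by [].
  have h1 := cble_cc (ble s s0 st) x0; have h2 := cble_oy (ble s s0 st) x0.
  rewrite -/(cdf0 _ _) in h1; rewrite /tot !(mv_oy _ x0) -!/(cdf0 _ _).
  by rewrite h1 andbT; lra.
- rewrite -[X in _ --> X]subr0; apply: cvgB; first exact: cvg_cst.
  by rewrite -(subrr (tot nu)); apply: cvgB => //; exact: cvg_cst.
- exact: cvg_cst.
Unshelve. all: by end_near. Qed.

Lemma DM_lincomb (K : nat) z (a : R -> fmeas R) (b : 'I_K -> R -> fmeas R) (i : 'I_K)
    (c : 'I_K -> R) :
  (forall j, 0 <= c j) -> (forall s, 0 <= s -> onRp (z s)) ->
  DMup a -> (forall j, DMup (b j)) ->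
  (forall s x, 0 <= s -> 0 <= x -> cdf0 (z s) x + cdf0 (b i s) x =
     cdf0 (a s) x + \sum_j c j * cdf0 (b j s) x) -> DM z.
Proof.
move=> c0 oz aM bM zE.
have oa s : 0 <= s -> onRp (a s) by move=> s0; apply: aM.1.1.
have ob j s : 0 <= s -> onRp (b j s) by move=> s0; apply: (bM j).1.1.
have rE s f : 0 <= s -> cb f ->
    rint (z s) f = rint (a s) f + \sum_j c j * rint (b j s) f - rint (b i s) f.
  move=> s0 cf; rewrite -(@rint_lincomb R K (z s) (b i s) (a s) (fun j => b j s) c)//; auto.
    by lra.
  by move=> x x0; exact: zE.
split=> //; split.
- move=> t t0 f cf; apply/cvg_rint => //; rewrite rE//.
  apply: (@cvg_trans _ ((rint (a s) f + \sum_j c j * rint (b j s) f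
      - rint (b i s) f) @[s --> t^'+])).
    apply: near_eq_cvg; near=> s; rewrite rE// (le_trans t0)//.
  apply: cvgB; last by apply/cvg_rint => //; exact: (bM i).1.2.1.
  apply: cvgD; first by apply/cvg_rint => //; exact: aM.1.2.1.
  apply: cvg_sumr => j; apply: cvgMr; apply/cvg_rint => //; exact: (bM j).1.2.1.
- move=> t t0.
  have [na [ona cva]] := aM.1.2.2 t t0.
  have /choice[nb hnb] : forall j, exists nu : fmeas R, onRp nu /\
      forall f, cb f -> mint (b j s) f @[s --> t^'-] --> mint nu f.
    by move=> j; exact: (bM j).1.2.2.
  (* The candidate left limit contains a subtraction. It is nonnegative and nondecreasing as a limit
     of the distribution functions of [z s], whereas right continuity comes from its separate
     terms. *)
  pose H x := cdf0 na x + \sum_j c j * cdf0 (nb j) x - cdf0 (nb i) x.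
  have HE x : 0 <= x -> cdf0 (z s) x @[s --> t^'-] --> H x.
    move=> x0.
    apply: (@cvg_trans _ ((cdf0 (a s) x + \sum_j c j * cdf0 (b j s) x
      - cdf0 (b i s) x) @[s --> t^'-])).
      apply: near_eq_cvg; near=> s; rewrite -zE//; first by lra.
      by near: s; exact: nbhs_left_ge.
    apply: cvgB; last by apply: DMup_left_cdf0 => //; exact: (hnb i).2.
    apply: cvgD; first exact: DMup_left_cdf0.
    by apply: cvg_sumr => j; apply: cvgMr; apply: DMup_left_cdf0 => //; exact: (hnb j).2.
  have iH : incr H.
    split=> [x x0|x y x0 xy].
      by apply: (ler_cvg_to (cvg_cst 0) (HE x x0)); apply: nearW => s; exact: mv_ge0.
    apply: (ler_cvg_to (HE x x0) (HE y (le_trans x0 xy))); apply: nearW => s.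
    exact: (mv_incr (z s)).2.
  have rH : rightc H.
    move=> x x0; apply: cvgB; last exact: mv_rightc.
    apply: cvgD; first exact: mv_rightc.
    by apply: cvg_sumr => j; apply: cvgMr; exact: mv_rightc.
  have [|nu onu nuE] := @fmeas_of_cdf R H (tot na + \sum_j c j * tot (nb j)) iH rH.
    move=> x x0; rewrite /H; have : 0 <= cdf0 (nb i) x by exact: mv_ge0.
    have := cdf0_le_tot na x0.
    have : \sum_j c j * cdf0 (nb j) x <= \sum_j c j * tot (nb j).
      by apply: ler_sum => j _; rewrite ler_wpM2l// cdf0_le_tot.
    lra.
  exists nu; split=> // f cf; apply/cvg_rint => //.
  have -> : rint nu f = rint na f + \sum_j c j * rint (nb j) f - rint (nb i) f.
    rewrite -(@rint_lincomb R K nu (nb i) na nb c)//; first by lra.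
    - exact: (hnb i).1.
    - by move=> j; exact: (hnb j).1.
    - by move=> x x0; rewrite nuE// /H /cdf0; lra.
  apply: (@cvg_trans _ ((rint (a s) f + \sum_j c j * rint (b j s) f
      - rint (b i s) f) @[s --> t^'-])).
    apply: near_eq_cvg; near=> s; rewrite rE//.
    by near: s; exact: nbhs_left_ge.
  apply: cvgB; last by apply/cvg_rint => //; exact: (hnb i).2.
  apply: cvgD; first by apply/cvg_rint => //; exact: cva.
  by apply: cvg_sumr => j; apply: cvgMr; apply/cvg_rint => //; exact: (hnb j).2.
Unshelve. all: by end_near. Qed.

End measure_paths.

(** * Complementarity conditions *)

Section complementarity.
Variable R : realType.
Local Notation T := (bR R).
Implicit Types (f g X : R -> R) (a b : R).
Local Hint Resolve measurable_Rp measurable_lt0 measurable_itvT : core.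

(** For nondecreasing [g]: the left limit of [ext0 g] at [a] equals its value at [b]. A jump at [a]
    is thus excluded, including the jump [g 0] from the value before time 0 when [a = 0]. *)
Definition flat g a b := forall e, 0 < e -> exists2 u, u < a & ext0 g b - ext0 g u < e.

Lemma ext0E g t : 0 <= t -> ext0 g t = g t.
Proof. by move=> t0; rewrite /ext0 ltNge t0. Qed.

Lemma dmeas_flat g a b : incr g -> rightc g -> a <= b ->
  dmeas g `[a, b]%classic = 0%E <-> flat g a b.
Proof.
move=> ig rg ab; split=> [g0 e e0|fl].
  have anb (n : nat) : a - n.+1%:R^-1 <= b by rewrite (le_trans _ ab)// gerBl invr_ge0.
  have : dmeas g `](a - n.+1%:R^-1), b]%classic @[n --> \oo] --> dmeas g `[a, b]%classic.
    rewrite [X in dmeas g X](_ : _ = \bigcap_n (`](a - n.+1%:R^-1), b]%classic : set T)).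
      apply: nonincreasing_cvg_mu => //.
      - by rewrite [ltLHS]dmeas_oc ?ltry.
      - by apply: bigcap_measurable => // k _; exact: measurable_itvT.
      - move=> n p np; apply/subsetPset/subset_itvr; rewrite bnd_simp.
        by rewrite lerD2l lerN2 lef_pV2 ?posrE// ler_nat.
    apply/seteqP; split=> [z /= + n _ /=|z hz /=].
      rewrite !in_itv/= => /andP[az ->]; rewrite andbT; apply: lt_le_trans az.
      by rewrite ltrBlDr ltrDl invr_gt0.
    have := hz 0%N I; rewrite /= !in_itv/= => /andP[_ ->]; rewrite andbT.
    rewrite leNgt; apply/negP => /ltr_add_invr[k hk].
    by have := hz k I; rewrite /= in_itv/= => /andP[]; rewrite ltrBlDr ltNge (ltW hk).
  rewrite g0 => /fine_cvgP[_] /cvgrPdist_lt/(_ e e0)[N _ /(_ N (leqnn N)) p].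
  exists (a - N.+1%:R^-1); first by rewrite ltrBlDr ltrDl invr_gt0.
  move: p; rewrite /= dmeas_oc//= sub0r normrN; apply: le_lt_trans; exact: ler_norm.
apply/eqP; rewrite -measure_le0; apply/lee_addgt0Pr => e e0; rewrite add0e.
have [u ua ue] := fl e e0.
apply: (@le_trans _ _ (dmeas g `]u, b]%classic)).
  apply: le_measure; rewrite ?inE//; apply: subset_itvr; by rewrite bnd_simp.
by rewrite dmeas_oc// ?(le_trans (ltW ua) ab)// lee_fin ltW.
Qed.

Lemma flatD f g h a b : incr f -> incr g -> (forall t, 0 <= t -> h t = f t + g t) ->
  flat f a b -> flat g a b -> flat h a b.
Proof.
move=> fi gi hE ff fg e e0; have e2 : 0 < e / 2 by rewrite divr_gt0.
have [u ua hu] := ff _ e2; have [v va hv] := fg _ e2.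
exists (Num.max u v); first by rewrite gt_max ua va.
have hE' t : ext0 h t = ext0 f t + ext0 g t.
  by rewrite /ext0; case: ltP => [_|/hE//]; rewrite addr0.
have := ext0_nd fi (_ : u <= Num.max u v); rewrite le_max lexx => /(_ isT).
have := ext0_nd gi (_ : v <= Num.max u v); rewrite le_max lexx orbT => /(_ isT).
rewrite !hE'; lra.
Qed.

Lemma flat_addl f g h a b : a <= b -> incr g -> (forall t, 0 <= t -> h t = f t + g t) ->
  flat h a b -> flat f a b.
Proof.
move=> ab gi hE fh e e0; have [u ua hu] := fh _ e0; exists u => //.
have hE' t : ext0 h t = ext0 f t + ext0 g t.
  by rewrite /ext0; case: ltP => [_|/hE//]; rewrite addr0.
have := ext0_nd gi (le_trans (ltW ua) ab); move: hu; rewrite !hE'; lra.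
Qed.

Lemma measurable_incr f : incr f -> measurable_fun (Rp (R:=R) : set T) f.
Proof.
move=> fi; apply: (@eq_measurable_fun _ _ T R _ (ext0 f)).
  by move=> x; rewrite inE => x0; rewrite ext0E.
apply: nondecreasing_measurable; first exact: measurable_Rp.
by move=> x y xy; exact: ext0_nd.
Qed.

Lemma sint0_null X g (A : set T) : incr g -> rightc g ->
  measurable_fun (Rp (R:=R) : set T) X -> (forall s, 0 <= s -> 0 <= X s) ->
  sint (EFin \o X) g = 0%E -> measurable A -> (forall s, A s -> 0 <= s /\ 0 < X s) ->
  dmeas g A = 0%E.
Proof.
move=> ig rg mX X0 sX mA AX.
have mEX : measurable_fun (Rp (R:=R) : set T) (EFin \o X) by exact/measurable_EFinP.
have : ae_eq (dmeas g) (Rp (R:=R) : set T) (EFin \o X) (cst 0%E).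
  apply/(ae_eq_integral_abs (lebesgue_stieltjes_measure _) (@measurable_Rp R) mEX).
  apply: etrans sX; apply: eq_integral => s.
  by rewrite inE => s0; rewrite /= ger0_norm// X0.
move=> h; apply/negligibleP => //; apply: negligibleS h => s /AX[s0 Xs] /=.
by apply/not_implyP; split=> //= -[] Xs0; rewrite Xs0 ltxx in Xs.
Qed.

(* Right continuity makes [{X > 0}] a countable union, over rational right end
   points, of intervals on which [X] is positive. *)
Lemma flat_sint0 X g : incr g -> rightc g -> rightc X ->
  measurable_fun (Rp (R:=R) : set T) X -> (forall s, 0 <= s -> 0 <= X s) ->
  (forall a b, 0 <= a -> a <= b -> (forall s, a <= s -> s <= b -> 0 < X s) -> flat g a b) ->
  sint (EFin \o X) g = 0%E.
Proof.
move=> ig rg rX mX X0 fl.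
have mEX : measurable_fun (Rp (R:=R) : set T) (EFin \o X) by exact/measurable_EFinP.
rewrite /sint; under eq_integral.
  move=> s; rewrite inE => s0.
  rewrite (_ : (EFin \o X) s = `|(EFin \o X) s|%E); last by rewrite /= ger0_norm// X0.
  over.
apply/(ae_eq_integral_abs (lebesgue_stieltjes_measure _) (@measurable_Rp R) mEX).
pose I q := [set s : R | 0 <= s <= q /\ forall r, s <= r -> r <= q -> 0 < X r].
(* An enumeration of the rationals, with the harmless value 0 for codes that decode to nothing. *)
pose qn (n : nat) : R := if unpickle n is Some q then ratr (q : rat) else 0.
apply: (@negligibleS _ T R (dmeas g) (\bigcup_n I (qn n))).
  move=> s /= /not_implyP[s0 Xs0].
  have {Xs0} Xs : 0 < X s.
    rewrite lt_neqAle X0// andbT; apply/eqP => e; apply: Xs0.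
    by rewrite /= -e.
  have /cvgrPdist_lt/(_ _ Xs)[e /= e0 he] := rX s s0.
  have [q] := @rat_in_itvoo R s (s + e) ltac:(by rewrite ltrDl).
  rewrite in_itv/= => /andP[sq qe].
  exists (pickle q) => //; rewrite /I /qn pickleK/=; split; first by rewrite s0 ltW.
  move=> r; rewrite le_eqVlt => /orP[/eqP<-//|sr] rq.
  have := he r; rewrite /= distrC ger0_norm ?subr_ge0 ?ltW// => /(_ _ sr).
  rewrite ltr_norml => h; have /h/andP[_] : r - s < e by rewrite ltrBlDl (le_lt_trans rq).
  by lra.
apply: negligible_bigcup => n; move: (qn n) => {n} q.
have Inull a : I q a -> (dmeas g).-negligible (`[a, q]%classic : set T).
  move=> [/andP[a0 aq] hX]; apply/negligibleP => //.
  by apply/dmeas_flat => //; apply: fl.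
have [->|/set0P I0] := eqVneq (I q) set0; first exact: negligible_set0.
have lbI : has_lbound (I q) by exists 0 => s [/andP[]].
have hI : has_inf (I q) by split.
pose a := inf (I q).
have Ia s : I q s -> a <= s by move=> Is; exact: ge_inf.
have Iup s r : I q s -> s <= r -> r <= q -> I q r.
  move=> [/andP[s0 sq] hX] sr rq; split; first by rewrite (le_trans s0 sr).
  by move=> v rv; apply: hX; exact: le_trans rv.
(* [I q] is an interval ending at [q]. If it lacks its infimum it is exhausted by closed intervals
   starting at [a + 1/(n+1)]. *)
have [aI|aI] := pselect (I q a).
  apply: negligibleS (Inull _ aI) => s Is /=; rewrite in_itv/= Ia//.
  by case: Is => /andP[].
apply: (@negligibleS _ T R (dmeas g) (\bigcup_n (`[a + n.+1%:R^-1, q]%classic : set T))).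
  move=> s Is; have : a < s.
    by rewrite lt_neqAle Ia// andbT; apply/eqP => e; apply: aI; rewrite e.
  move=> /ltr_add_invr[k hk]; exists k => //=; rewrite in_itv/= (ltW hk)/=.
  by case: Is => /andP[].
apply: negligible_bigcup => n; have [aq|qa] := leP (a + n.+1%:R^-1) q; last first.
  by rewrite set_itv_ge ?bnd_simp -?ltNge//; exact: negligible_set0.
apply: Inull; have [|s Is sa] := @inf_adherent _ _ (n.+1%:R^-1 : R) _ hI.
  by rewrite invr_gt0.
by apply: Iup Is (ltW sa) aq.
Qed.

(** * The regulator characterised by complementarity *)

Section reflection.
Variables (mu A : R -> R).
Hypotheses (mui : incr mu) (Ai : incr A).

(** [L >= reg mu A] is minimality of the regulator. If [L] exceeded [l = reg mu A t] at time [t],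
    then [X > 0] on the set [S] of times up to [t] where [L > l], so neither [g1] nor [g2] charges
    [S], and [L] could not have risen above [l]. *)
Lemma reg_unique (g1 g2 L : R -> R) : incr g1 -> rightc g1 -> incr g2 -> rightc g2 ->
  (forall t, 0 <= t -> L t = g1 t + g2 t) ->
  let X t := A t - mu t + L t in
  measurable_fun (Rp (R:=R) : set T) X -> (forall t, 0 <= t -> 0 <= X t) ->
  sint (EFin \o X) g1 = 0%E -> sint (EFin \o X) g2 = 0%E ->
  forall t, 0 <= t -> L t = reg mu A t.
Proof.
move=> i1 r1 i2 r2 LE X mX X0 s1 s2 t t0.
have iL : incr L by apply: eq_incr (incrD i1 i2) => s s0; rewrite LE.
apply/le_anti/andP; split; last first.
  apply: reg_le => //; first exact: iL.1.
  move=> s s0 st; have := X0 s s0; have := iL.2 s t s0 st; rewrite /X; lra.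
rewrite leNgt; apply/negP => lt_t.
pose l := reg mu A t; have l0 : 0 <= l by exact: reg_ge0.
pose S := [set s | 0 <= s <= t /\ l < L s].
have XS s : S s -> 0 < X s.
  move=> [/andP[s0 st] ls]; have := reg_ub mui Ai s0 st; rewrite /X -/l; lra.
have St : S t by rewrite /S/= t0 lexx.
have lbS : has_lbound S by exists 0 => s [/andP[]].
have hS : has_inf S by split=> //; exists t.
pose tau := inf S.
have tau0 : 0 <= tau by apply: lb_le_inf; [exists t|move=> s [/andP[]]].
have taut : tau <= t by exact: ge_inf.
have Sup s : tau < s -> s <= t -> S s.
  move=> ts st; split; first by rewrite st (le_trans tau0 (ltW ts)).
  have [|r [/andP[r0 rt] lr] rs] := @inf_adherent _ S (s - tau) _ hS; first by rewrite subr_gt0.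
  by apply: lt_le_trans lr _; apply: iL.2 => //; rewrite addrC subrK in rs; exact: ltW.
(* If [tau] is in [S], a jump at [tau] must be excluded too. The closed interval is null, and
   flatness yields [u < tau] with [ext0 L u > l]: impossible for [u < 0] as [l >= 0], and against
   the choice of [tau] otherwise. *)
have [Stau|nS] := pselect (S tau).
  have Xpos s : (`[tau, t]%classic : set T) s -> 0 <= s /\ 0 < X s.
    rewrite /= in_itv/= => /andP[ts st]; split; first exact: le_trans ts.
    move: ts; rewrite le_eqVlt => /orP[/eqP<-|ts]; first exact: XS.
    by apply: XS; exact: Sup.
  have fl : flat L tau t.
    by apply: (flatD i1 i2 LE); apply/dmeas_flat => //; apply: sint0_null Xpos.
  have [|u utau] := fl (L t - l); first by rewrite subr_gt0.
  rewrite (ext0E _ t0).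
  suff : ext0 L u <= l by lra.
  rewrite /ext0; case: ltP => // u0; rewrite leNgt; apply/negP => lu.
  suff : tau <= u by rewrite leNgt utau.
  by apply: ge_inf => //; split => //; rewrite u0 (le_trans (ltW utau)).
(* If [tau] is outside [S], both summands take the same value at [tau] and [t], so [L tau > l] after
   all. *)
have Xpos s : (`]tau, t]%classic : set T) s -> 0 <= s /\ 0 < X s.
  rewrite /= in_itv/= => /andP[ts st]; split; first exact: le_trans (ltW ts).
  by apply: XS; exact: Sup.
have gE g : incr g -> rightc g -> sint (EFin \o X) g = 0%E -> g t = g tau.
  move=> ig rg sg; have := sint0_null ig rg mX X0 sg (measurable_itvT _) Xpos.
  rewrite dmeas_oc// !ext0E// => -[]; lra.
apply: nS; split; first by rewrite tau0.
by rewrite LE// -(gE g1)// -(gE g2)// -LE.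
Qed.

(** [g1] is only a part of the regulator; since [g2] is nondecreasing as well, [g1] is flat wherever
    [reg mu A] is. Exchanging the two parts gives (2) and (3). *)
Lemma reg_complementarity (g1 g2 : R -> R) : rightc A -> rightc mu ->
  incr g1 -> rightc g1 -> incr g2 -> (forall t, 0 <= t -> reg mu A t = g1 t + g2 t) ->
  sint (fun t => (A t - mu t + reg mu A t)%:E) g1 = 0%E.
Proof.
move=> rA rmu i1 r1 i2 gE.
have ireg := reg_incr mui Ai.
have rreg : rightc (reg mu A).
  have rt : rightc (thr mu A).
    apply: rightc_incr_le (thr_incr mui Ai) _ rmu.
    by apply: eq_incr ireg => t _; rewrite /thr; lra.
  move=> t t0; rewrite (_ : reg mu A = fun s => mu s - thr mu A s).
    by apply: cvgB; [exact: rmu|exact: rt].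
  by apply/funext => s; rewrite /thr; lra.
apply: flat_sint0 => //.
- move=> t t0; apply: cvgD; last exact: rreg.
  by apply: cvgB; [exact: rA|exact: rmu].
- apply: measurable_funD; last exact: measurable_incr.
  by apply: measurable_funB; exact: measurable_incr.
- by move=> s s0; have := reg_ub mui Ai s0 (lexx s); lra.
(* A failure of flatness would keep the regulator before [a] at least [e] below its value at [b];
   [reg_flat] with [c = reg mu A b - e] forbids this. *)
move=> a b a0 ab hX; apply: (flat_addl ab i2 gE) => e e0; apply: contrapT => h.
have nh u : u < a -> ext0 (reg mu A) u <= reg mu A b - e.
  move=> ua; rewrite leNgt; apply/negP => hu; apply: h; exists u => //.
  by rewrite (ext0E _ (le_trans a0 ab)); lra.
suff : reg mu A b <= reg mu A b - e by lra.
apply: (@reg_flat R mu mui A a) => //.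
(* A negative time shows [c >= 0], as [ext0] vanishes there. *)
- have := nh (-1); rewrite /ext0 ltrN10; apply; exact: lt_le_trans (ltrN10 _) a0.
- by move=> u u0 ua; have := nh u ua; rewrite ext0E.
Qed.

End reflection.

End complementarity.

(** * The vector measure valued Skorokhod problem *)

Section skorokhod.
Variables (R : realType) (K : nat) (P : 'M[R]_K).
Variables (alpha : 'I_K -> R -> fmeas R) (mu : 'I_K -> R -> R).
Hypotheses (sP : substochastic P) (cP : convergent P).
Hypotheses (aM : forall i, DMup (alpha i)) (muD : forall i, Dup (mu i)).
Local Notation T := (bR R).
Local Hint Resolve measurable_Rp measurable_lt0 measurable_itvT : core.

Lemma Dup_of_incr (f : R -> R) : incr f -> rightc f -> Dup f.
Proof.
move=> fi fr; split; last by case: fi.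
split=> // t t0; apply: nondecreasing_at_left_is_cvgr; near=> x.
- have x0 : 0 <= x by near: x; exact: nbhs_left_ge.
  move=> u v; rewrite !in_itv/= => /andP[xu _] _ uv.
  by apply: fi.2 => //; exact: le_trans (ltW xu).
- have x0 : 0 <= x by near: x; exact: nbhs_left_ge.
  exists (f t) => _ [y /= + <-]; rewrite in_itv/= => /andP[xy yt].
  by apply: fi.2; [exact: le_trans (ltW xy)|exact: ltW].
Unshelve. all: by end_near. Qed.

Lemma Dup_incr (f : R -> R) : Dup f -> incr f. Proof. by case=> _ []. Qed.

Lemma Dup_rightc (f : R -> R) : Dup f -> rightc f. Proof. by case=> -[]. Qed.

Lemma eq_rightc (f g : R -> R) : (forall t, 0 <= t -> f t = g t) -> rightc f -> rightc g.
Proof.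
move=> fg rf t t0; rewrite -fg//; apply: cvg_trans (rf t t0).
by apply: near_eq_cvg; near=> s; rewrite fg// (le_trans t0).
Unshelve. all: by end_near. Qed.

Let mui i : incr (mu i) := Dup_incr (muD i).
Let rmu i : rightc (mu i) := Dup_rightc (muD i).

Lemma reflectionE i (b : 'I_K -> R) :
  \sum_j (1%:M - P^T) i j * b j = b i - \sum_j P j i * b j.
Proof.
under eq_bigr do rewrite !mxE mulrBl.
rewrite sumrB; congr (_ - _); rewrite (bigD1 i)//= eqxx mul1r big1 ?addr0// => j ji.
by rewrite eq_sym (negbTE ji) mul0r.
Qed.

Definition arr x i t := cdf0 (alpha i t) x.

Lemma arr_incr x i : 0 <= x -> incr (arr x i).
Proof. exact: DMup_cc_incr. Qed.

Lemma arr_rightc x i : 0 <= x -> rightc (arr x i).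
Proof. exact: DMup_cc_rightc. Qed.

Lemma inflow_rightc x i B : 0 <= x -> is_flow P mu (arr x) B ->
  rightc (inflow P (arr x) B i).
Proof.
move=> x0 fB t t0; apply: cvgD; first exact: arr_rightc.
apply: cvg_sumr => j; apply: cvgMr; apply: (flow_rightc sP mui _ rmu fB) => //.
by move=> k; exact: arr_incr.
Qed.

(** At level [x] the reflected path is [xi[0,x]] and the regulator splits as [beta(x,oo) + iota], so
    (2) and (3) are the complementarity of the two summands in [reg_unique]. *)
Lemma solution_flow xi beta iota x : 0 <= x ->
  (forall i, DMup (beta i)) -> (forall i, Dup (iota i)) ->
  VMVSP P alpha mu xi beta iota -> is_flow P mu (arr x) (fun i t => cdf0 (beta i t) x).
Proof.
move=> x0 bM iD /(_ x x0)[h1 h2 h3 h4]; set B := fun _ _ => _.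
have iB i : incr (B i) by exact: DMup_cc_incr.
split=> // i t t0.
have iA : incr (inflow P (arr x) B i) by apply: inflow_incr => // j; exact: arr_incr.
pose g1 s := mv (beta i s) `]x, +oo[%classic.
pose L s := g1 s + iota i s.
have i1 : incr g1 by exact: DMup_oy_incr.
have LE s : 0 <= s -> L s = mu i s - B i s.
  by move=> s0; rewrite -h4// (mv_oy _ x0) /L /g1 /B /cdf0; lra.
pose X s := inflow P (arr x) B i s - mu i s + L s.
have XE s : 0 <= s -> X s = mv (xi i s) `[0, x]%classic.
  by move=> s0; rewrite /X LE// h1// reflectionE /inflow /arr /B /cdf0; lra.
have sE g : sint (EFin \o X) g = sint (fun s => xi i s `[0, x]%classic) g.
  by apply: eq_integral => s; rewrite inE => s0; rewrite /= XE// -mvE.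
have iL : incr L by apply: incrD => //; exact: Dup_incr.
have := @reg_unique R (mu i) _ (mui i) iA g1 (iota i) L i1 (DMup_oy_rightc (bM i) x0)
  (Dup_incr (iD i)) (Dup_rightc (iD i)) (fun _ _ => erefl).
rewrite /thr => <- //.
- by rewrite LE//; lra.
- apply: measurable_funD; last exact: measurable_incr.
  by apply: measurable_funB; exact: measurable_incr.
- by move=> s s0; rewrite -/(X s) XE//; exact: mv_ge0.
- by rewrite sE.
- by rewrite sE.
Qed.

Lemma arr_homo x y i : 0 <= x -> x <= y -> incr_le (arr x i) (arr y i).
Proof. by move=> x0 xy; exact: DMup_cc_incr_le. Qed.

(** [Binf] is the flow driven by the total masses rather than the limit of [B x] by definition: its
    regularity in time is then that of a flow, and [flow_cvg] identifies it with the limit. *)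
Lemma flow_family : exists (B : R -> 'I_K -> R -> R) (Binf : 'I_K -> R -> R),
  [/\ forall x : R, 0 <= x -> is_flow P mu (arr x) (B x),
      forall i, incr (Binf i), forall i, rightc (Binf i),
      forall i, incr (fun t => mu i t - Binf i t) &
      forall i (t : R), 0 <= t -> [/\ incr (fun x => B x i t), rightc (fun x => B x i t) &
        B n%:R i t @[n --> \oo] --> Binf i t]].
Proof.
have /choice[B fB] : forall x : R, exists B, 0 <= x -> is_flow P mu (arr x) B.
  move=> x; have [x0|x0] := ltP x 0; first by exists (fun _ _ => 0).
  by have [C fC _] := least_flow sP mui (fun i => arr_incr i x0); exists C.
have iat i : incr (fun t => tot (alpha i t)) by exact: DMup_total_incr.
have [Binf finf _] := least_flow sP mui iat.
exists B, Binf; split=> //.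
- exact: finf.1.
- by move=> i; exact: (flow_rightc sP mui iat rmu finf).
- move=> i; apply: eq_incr (reg_incr (mui i) (inflow_incr sP i iat finf.1)) => t t0.
  by rewrite finf.2// /thr; lra.
move=> i t t0.
have Bi : incr (fun x => B x i t).
  split=> [x x0|x y x0 xy]; first exact: ((fB x x0).1 i).1.
  have y0 := le_trans x0 xy; apply: incr_leP t0.
  exact: (flow_homo sP cP mui (fun i => arr_incr i x0) (fun i => arr_homo i x0 xy)
    (fB x x0) (fB y y0)).
split=> //.
- apply: rightc_seq => [x y x0 xy|x x0]; first exact: Bi.2.
  have xn0 (n : nat) : 0 <= x + n.+1%:R^-1 by rewrite addr_ge0// invr_ge0.
  move: i {Bi}; apply: (@flow_cvg _ _ _ _ sP cP mui (fun n => arr (x + n.+1%:R^-1))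
    (fun n => B (x + n.+1%:R^-1)) (arr x)) => //.
  + by move=> n i; exact: arr_incr.
  + by move=> i; exact: arr_incr.
  + by move=> n; exact: fB.
  + exact: fB.
  + move=> i; have /cvg_at_rightP := @mv_rightc R (alpha i t) x x0; apply; split.
      by move=> n; rewrite ltrDl invr_gt0.
    rewrite -[X in _ --> X]addr0; apply: cvgD; first exact: cvg_cst.
    exact: cvg_harmonic.
  + right; split=> [n m i nm|n i]; apply: arr_homo => //.
      by rewrite lerD2l lef_pV2 ?posrE// ler_nat.
    by rewrite lerDl invr_ge0.
- move: i {Bi}; apply: (@flow_cvg _ _ _ _ sP cP mui (fun n => arr n%:R)
    (fun n => B n%:R) (fun i t => tot (alpha i t))) => //.
  + by move=> n i; exact: arr_incr.
  + by move=> n; exact: fB.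
  + by move=> i; exact: mv_cvgy.
  + left; split=> [n m i nm|n i]; last exact: DMup_cc_total_incr_le.
    by apply: arr_homo => //; rewrite ler_nat.
Qed.

Lemma solution_exists : exists (xi beta : 'I_K -> R -> fmeas R) (iota : 'I_K -> R -> R),
  [/\ (forall i, DM (xi i)), (forall i, DMup (beta i)), (forall i, Dup (iota i))
    & VMVSP P alpha mu xi beta iota].
Proof.
have [B [Binf [fB iBinf rBinf iiota BP]]] := flow_family.
have Ble x i t : 0 <= x -> 0 <= t -> B x i t <= Binf i t.
  move=> x0 t0; have [Bi _ cv] := BP i t t0.
  apply: (ler_cvg_to (cvg_cst _) cv); near=> n.
  by apply: Bi.2 => //; near: n; exact: nbhs_infty_ger.
have /choice[bb bbP] : forall p : 'I_K * R, exists m : fmeas R, 0 <= p.2 ->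
    onRp m /\ forall x, 0 <= x -> cdf0 m x = B x p.1 p.2.
  (* At negative times any inhabitant of the type will do. *)
  move=> [i t]/=; have [t0|t0] := ltP t 0; first by exists (alpha i t).
  have [Bi rB _] := BP i t t0.
  by have [|m om mE] := @fmeas_of_cdf R _ (Binf i t) Bi rB; [move=> x x0; exact: Ble|exists m].
pose beta i t := bb (i, t).
have betaR i t : 0 <= t -> onRp (beta i t) by move=> t0; exact: (bbP (i, t) t0).1.
have betaE i t x : 0 <= t -> 0 <= x -> cdf0 (beta i t) x = B x i t.
  by move=> t0; exact: (bbP (i, t) t0).2.
have betaT i t : 0 <= t -> tot (beta i t) = Binf i t.
  move=> t0; have [_ _ cv] := BP i t t0.
  have := @mv_cvgy R (beta i t); under eq_fun do rewrite -/(cdf0 _ _) betaE//.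
  by move=> h; exact: cvg_unique h cv.
have betaM i : DMup (beta i).
  apply: DMup_of_cdf0.
  - by move=> s; exact: betaR.
  - move=> s r s0 sr; have r0 := le_trans s0 sr.
    split=> [x x0|x y x0 xy].
      by rewrite !betaE// subr_ge0; exact: ((fB x x0).1 i).2.
    have y0 := le_trans x0 xy; rewrite !betaE//.
    (* The mass of []x, y]] under [beta] grows in time because the order between the flows at levels
       [x] and [y] includes increments. *)
    have h := flow_homo sP cP mui (fun i => arr_incr i x0) (fun i => arr_homo i x0 xy)
      (fB x x0) (fB y y0).
    by have := (h i).2 s r s0 sr; lra.
  - by apply: eq_rightc (rBinf i) => t t0; rewrite betaT.
pose X x i t := inflow P (arr x) (B x) i t - B x i t.
have XE x i t : 0 <= x -> 0 <= t ->
    X x i t = inflow P (arr x) (B x) i t - mu i t + reg (mu i) (inflow P (arr x) (B x) i) t.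
  by move=> x0 t0; rewrite /X (fB x x0).2// /thr; lra.
have iA x i : 0 <= x -> incr (inflow P (arr x) (B x) i).
  by move=> x0; apply: inflow_incr => //; [move=> j; exact: arr_incr|exact: (fB x x0).1].
have /choice[xx xxP] : forall p : 'I_K * R, exists m : fmeas R, 0 <= p.2 ->
    onRp m /\ forall x, 0 <= x -> cdf0 m x = X x p.1 p.2.
  move=> [i t]/=; have [t0|t0] := ltP t 0; first by exists (alpha i t).
  have [|||m om mE] := @fmeas_of_cdf R (fun x => X x i t)
    (tot (alpha i t) + \sum_j P j i * Binf j t).
  (* Nonnegativity is that of the reflected path; growth in [x] is [flow_lip] at the single time
     [t], rearranged. *)
  - split=> [x x0|x y x0 xy].
      by rewrite XE//; have := reg_ub (mui i) (iA x i x0) t0 (lexx t); lra.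
    have y0 := le_trans x0 xy.
    have := flow_lip sP cP mui i (fun i => arr_incr i x0) (fun i => arr_homo i x0 xy)
      (fB x x0) (fB y y0) t0.
    under eq_bigr do rewrite mulrBr.
    by rewrite sumrB /X /inflow; lra.
  - move=> x x0; have [_ rB _] := BP i t t0; apply: cvgB; last exact: rB.
    apply: cvgD; first exact: mv_rightc.
    by apply: cvg_sumr => j; apply: cvgMr; have [_ rBj _] := BP j t t0; exact: rBj.
  - move=> x x0; rewrite /X /inflow /arr.
    have := cdf0_le_tot (alpha i t) x0; have := ((fB x x0).1 i).1 t t0.
    have : \sum_j P j i * B x j t <= \sum_j P j i * Binf j t.
      by apply: ler_sum => j _; apply: ler_wpM2l; [exact: sP.1|exact: Ble].
    lra.
  by exists m.
pose xi i t := xx (i, t).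
have xiR i t : 0 <= t -> onRp (xi i t) by move=> t0; exact: (xxP (i, t) t0).1.
have xiE i t x : 0 <= t -> 0 <= x -> cdf0 (xi i t) x = X x i t.
  by move=> t0; exact: (xxP (i, t) t0).2.
pose iota i t := mu i t - Binf i t.
have iotaR i : rightc (iota i).
  by move=> t t0; apply: cvgB; [exact: rmu|exact: rBinf].
exists xi, beta, iota; split=> //.
- move=> i; apply: (@DM_lincomb R K (xi i) (alpha i) beta i (fun j => P j i)) => //.
  + by move=> j; exact: sP.1.
  + by move=> s; exact: xiR.
  + move=> s x s0 x0; rewrite xiE// /X betaE// subrK /inflow; congr (_ + _).
    by apply: eq_bigr => j _; rewrite betaE.
- by move=> i; exact: Dup_of_incr (iiota i) (iotaR i).
move=> x x0.
have sE i g : sint (fun s => xi i s `[0, x]%classic) g =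
    sint (fun s => (inflow P (arr x) (B x) i s - mu i s +
      reg (mu i) (inflow P (arr x) (B x) i) s)%:E) g.
  apply: eq_integral => s; rewrite inE => s0.
  by rewrite mvE// -/(cdf0 _ _) xiE// XE.
have gE i t : 0 <= t -> reg (mu i) (inflow P (arr x) (B x) i) t =
    mv (beta i t) `]x, +oo[%classic + iota i t.
  move=> t0; have := (fB x x0).2 i t t0; rewrite /thr.
  have := betaT i t t0; rewrite /tot (mv_oy _ x0) -/(cdf0 _ _) betaE// /iota; lra.
split.
- move=> i s s0; rewrite reflectionE -!/(cdf0 _ _) xiE// betaE// /X /inflow.
  under [X in _ = _ - (_ - X)]eq_bigr do rewrite -/(cdf0 _ _) betaE//.
  by rewrite /arr; lra.
- move=> i; rewrite sE.
  apply: (@reg_complementarity R (mu i) _ (mui i) (iA x i x0) _ (iota i)) => //.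
  + by apply: inflow_rightc => //; exact: fB.
  + exact: (DMup_oy_incr (betaM i) x0).
  + exact: (DMup_oy_rightc (betaM i) x0).
  + exact: iiota.
  + exact: gE.
- move=> i; rewrite sE.
  apply: (@reg_complementarity R (mu i) _ (mui i) (iA x i x0) _
    (fun t => mv (beta i t) `]x, +oo[%classic)) => //.
  + by apply: inflow_rightc => //; exact: fB.
  + exact: iiota.
  + exact: (DMup_oy_incr (betaM i) x0).
  + by move=> t t0; rewrite gE// addrC.
- by move=> i s s0; rewrite -/(tot _) betaT// /iota; lra.
Unshelve. all: by end_near. Qed.

Lemma solution_unique xi beta iota xi' beta' iota' :
  (forall i, DM (xi i)) -> (forall i, DMup (beta i)) -> (forall i, Dup (iota i)) ->
  VMVSP P alpha mu xi beta iota ->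
  (forall i, DM (xi' i)) -> (forall i, DMup (beta' i)) -> (forall i, Dup (iota' i)) ->
  VMVSP P alpha mu xi' beta' iota' ->
  forall i t, 0 <= t ->
    [/\ (forall A : set T, measurable A -> xi' i t A = xi i t A),
        (forall A : set T, measurable A -> beta' i t A = beta i t A)
      & iota' i t = iota i t].
Proof.
move=> xD bM iD sol xD' bM' iD' sol' i t t0.
have cE j x : 0 <= x -> mv (beta' j t) `[0, x]%classic = mv (beta j t) `[0, x]%classic.
  move=> x0; exact: (flow_unique sP cP mui j (fun i => arr_incr i x0)
    (solution_flow x0 bM' iD' sol') (solution_flow x0 bM iD sol) t0).
have bE A : measurable A -> beta' i t A = beta i t A.
  by apply: fmeas_eq; [exact: (bM' i).1.1|exact: (bM i).1.1|exact: cE].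
split=> //.
  apply: fmeas_eq; [exact: (xD' i).1|exact: (xD i).1|].
  move=> x x0; have [-> // _ _ _] := sol' x x0; have [-> // _ _ _] := sol x x0.
  by congr (_ - _); apply: eq_bigr => j _; rewrite cE.
(* Condition (4) is the same at every level [x], so it is read off at level 0. *)
have [_ _ _ /(_ i t t0)] := sol' 0 (lexx _); have [_ _ _ /(_ i t t0)] := sol 0 (lexx _).
by rewrite /mv bE//; lra.
Qed.

End skorokhod.

Theorem theorem2p3 (R : realType) (K : nat) (hK : (1 <= K)%N) (P : 'M[R]_K)
  (alpha : 'I_K -> R -> fmeas R) (mu : 'I_K -> R -> R) :
  substochastic P -> convergent P ->
  (forall i, DMup (alpha i)) -> (forall i, Dup (mu i)) -> (forall i, mu i 0 = 0) ->
  exists (xi beta : 'I_K -> R -> fmeas R) (iota : 'I_K -> R -> R),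
    [/\ (forall i, DM (xi i)), (forall i, DMup (beta i)), (forall i, Dup (iota i))
      & VMVSP P alpha mu xi beta iota] /\
    (forall (xi' beta' : 'I_K -> R -> fmeas R) (iota' : 'I_K -> R -> R),
      (forall i, DM (xi' i)) -> (forall i, DMup (beta' i)) -> (forall i, Dup (iota' i)) ->
      VMVSP P alpha mu xi' beta' iota' ->
      forall i t, 0 <= t ->
        [/\ (forall A : set (bR R), measurable A -> xi' i t A = xi i t A),
            (forall A : set (bR R), measurable A -> beta' i t A = beta i t A)
          & iota' i t = iota i t]).
Proof.
move=> sP cP aM muD _.
have [xi [beta [iota [xD bM iD sol]]]] := solution_exists sP cP aM muD.
exists xi, beta, iota; split=> // xi' beta' iota' xD' bM' iD' sol' i t t0.
exact: (solution_unique sP cP aM muD xD bM iD sol xD' bM' iD' sol').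
Qed.
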